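(* Let $(z_n)$ be the sequence in the Hilbert space $H$ described in the context. Assume there exist $c\in\mathbb{N}\setminus\{0\}$ and monotone functions $h:\mathbb{N}\to\mathbb{N}\setminus\{0\}$ and $\ell,L,E:\mathbb{N}\to\mathbb{N}$ such that (1) $\lambda_n\ge \frac{1}{h(n)}$ for all $n\in\mathbb{N}$; (2) $\lambda_n\le\frac1{k+1}$ for all $k\in\mathbb{N}$ and $n\ge \ell(k)$; (3) $\sum_{i=1}^{L(k)}\lambda_i\ge k$ for all $k\in\mathbb{N}$; (4) $\min\{c_n,\delta_n^2\}\ge\frac1c$ for all $n\in\mathbb{N}$; (5) either $\sum_{i=E(k)+1}^{E(k)+n}\|e_i\|\le\frac{1}{k+1}$ for all $k,n\in\mathbb{N}$, or $\frac{\|e_n\|}{\lambda_n}\le\frac1{k+1}$ for all $k\in\mathbb{N}$ and $n\ge E(k)$. Let $D\in\mathbb{N}\setminus\{0\}$ be such that $D\ge\max\{2\|u-p\|,\|z_0-p\|\}$ for some $p\in S$, and let $\mathsf{C}:\mathbb{N}\to\mathbb{N}$ be a monotone function with $c_n\le \mathsf{C}(n)$ for all $n$. Let $d_0,d_1,d_2\in\mathbb{N}\setminus\{0\}$ satisfy $d_0\ge\max\{\|u-q\|,\|z_0-q\|\}$ for some $q\in S$, $d_1\ge\sum_{i=0}^{E(0)}\|e_i\|+1$, and $d_2\ge\max\{\|z_i-y_i\|: i\le E(0)\}$. Write $J_i=J_{c_i}$ and $J=J_{1/c}$. Then for all $k\in\mathbb{N}$ and every monotone function $f:\mathbb{N}\to\mathbb{N}$: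 (i) $\exists n\le\widetilde\nu(k,f)\ \forall i\in[n,f(n)]\ \left(\|J_i(z_i)-z_i\|\le\frac1{k+1}\right)$; (ii) $\exists n\le\widetilde\nu(2k+1,f)\ \forall i\in[n,f(n)]\ \left(\|J(z_i)-z_i\|\le\frac1{k+1}\right)$. Here $\widetilde\nu(k,f)=\max\{\widetilde\mu(2k+1,\breve f),\Theta(4k+3)\}$ with $\breve f(m)=f(\max\{m,\Theta(4k+3)\})$; $\Theta(j)=L\left(E(3j+2)+\lceil\ln(3d(j+1))\rceil\right)+1$ with $d=\max\{2d_0+d_1,d_2\}$; $\widetilde\mu(k,f)=\max\{\mu(16c^2(k+1)^2-1,\check f+1),\ \ell(4cD(k+1)-1)\}$ with $\check f(m)=f(\max\{m,\ell(4cD(k+1)-1)\})$; and $\mu$ is the functional defined in the context from $c,D,\mathsf{C},h,\ell,L$.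
   Context: Conventions: $\mathbb{N}=\{0,1,2,\dots\}$; $[a,b]$ with $a,b\in\mathbb{N}$ is the set of integers $i$ with $a\le i\le b$ (empty if $b<a$); $g^{(j)}$ is the $j$-fold iterate of $g$ ($g^{(0)}=\mathrm{id}$); $g+1$, $g+2$ are the functions $n\mapsto g(n)+1$, $n\mapsto g(n)+2$. A function $f:\mathbb{N}\to\mathbb{N}$ is monotone if $f(n)\le f(n+1)$ for all $n$. The auxiliary functions $\breve f$ and $\check f$ depend on the first argument at which $\widetilde\nu$, respectively $\widetilde\mu$, is evaluated. Setting: $H$ is a real Hilbert space, $\mathsf{A}:H\to2^H$ is a maximal monotone operator with $S:=\mathsf{A}^{-1}(0)\ne\emptyset$, and for $\sigma>0$, $J_\sigma=(I+\sigma\mathsf{A})^{-1}$ is its (single-valued, everywhere defined) resolvent. Given are $u,z_0\in H$, $(e_n)\subset H$, $(c_n)\subset(0,+\infty)$, $(\lambda_n),(\delta_n)\subset(0,1)$, $(\gamma_n)\subset[0,1)$ with $\lambda_n+\gamma_n+\delta_n=1$ for all $n\in\mathbb{N}$. The sequences $(z_n),(y_n)$ are defined by $z_{n+1}=\lambda_nu+\gamma_nz_n+\delta_nJ_{c_n}(z_n)+e_n$ and $y_0=z_0$, $y_{n+1}=\lambda_nu+\gamma_ny_n+\delta_nJ_{c_n}(y_n)$. Definition of $\mu(k,f)$ for $k\in\mathbb{N}$ and monotone $f:\mathbb{N}\to\mathbb{N}$ (with $c,D,\mathsf{C},h,\ell,L$ fixed; when $\mu$ is evaluated at other arguments, all auxiliary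 functions are formed with those arguments in place of $k,f$). For $j,n\in\mathbb{N}$ and $g:\mathbb{N}\to\mathbb{N}$: - $\zeta(j,n)=c(j+1)\mathsf{C}(n)-1$; - $\overline{\sigma}(j,n)=L\left(n+\lceil\ln(12D^2(j+1))\rceil\right)+1$; - $\phi_2(j,n,g)=\max\{n,g^{(4D^2(j+1))}(n)\}$ and $\phi_1(j,n,g)=g(\phi_2(j,n,g))$; - $\widetilde f(n)=f(\overline{\sigma}(k,n))$; - $r_1(n)=12c(n+1)^2-1$; - $r_2(n)=\max\{2(n+1),128D(k+1)^2\}$; - $r_3(n)=\ell\left(\max\{96cD^2(n+1)^2-1,\ 256D^2(k+1)^2-1,\ 16c(r_2(n))^2D^2\}\right)$; - $r_4(n)=3(k+1)\left(\widetilde f(\phi_2(r_1(n),r_3(n),\widetilde f+2))+1\right)$; - $\Phi(n)=\phi_1(r_1(n),r_3(n),\widetilde f+2)$; - $\Xi_1(n)=\zeta\left(2(6D+1)\max\{r_1(n),r_4(n)\}-1,\ \phi_1(r_1(n),r_3(n),\widetilde f+2)\right)$; - $\xi(n)=\zeta\left(\max\{16h(f(n))(k+1)^2(6D+1),\ 4c(r_2(n))^2(6D+1)\},\ f(n)\right)$; - $\Xi_2(n)=\xi(\Phi(n))$ and $\Xi(n)=\max\{\Xi_1(n),\Xi_2(n)\}$. For $j\in\mathbb{N}$ and monotone $g:\mathbb{N}\to\mathbb{N}$: $\beta(j,g)=24D\left(w_g^{(R)}(0)+1\right)^2$ with $R=4D^4(j+1)^2$ and $w_g(m)=\max\{g(24D(m+1)^2),24D(m+1)^2\}$.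 With $\overline{k}=32(k+1)^2-1$, $\bar r=r_1(\beta(\overline{k},\Xi))$, $\bar n=r_3(\beta(\overline{k},\Xi))$, $$\mu(k,f)=\max\left\{\overline{\sigma}(k,\phi_2(\bar r,\bar n,\widetilde f+2)),\ \Phi(\beta(\overline{k},\Xi))\right\}.$$ *)

(* Defs.v *)
From HB Require Import structures.
From mathcomp Require Import all_boot all_order all_algebra sesquilinear.
From mathcomp Require Import all_classical all_reals all_analysis.

Set Implicit Arguments.
Unset Strict Implicit.
Unset Printing Implicit Defensive.

Import Order.TTheory GRing.Theory Num.Theory.
Import numFieldNormedType.Exports.

Local Open Scope classical_set_scope.
Local Open Scope ring_scope.

Definition monotone_fun (f : nat -> nat) : Prop := forall n, (f n <= f n.+1)%N.

(* A real Hilbert space is a complete normed module [H] over [R] together with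
   a positive definite symmetric form [ip : {dot H for idfun}] inducing the norm
   in the sense of [norm_of_dot].  A set-valued operator is a map [H -> set H]. *)
Section Operators.
Variables (R : realType) (H : completeNormedModType R).

Definition norm_of_dot (ip : {dot H for idfun}) : Prop :=
  forall x : H, `|x| ^+ 2 = ip x x.

Definition monotone_op (ip : {dot H for idfun}) (A : H -> set H) : Prop :=
  forall x y v w : H, A x v -> A y w -> 0 <= ip (x - y) (v - w).

Definition maximal_monotone (ip : {dot H for idfun}) (A : H -> set H) : Prop :=
  monotone_op ip A /\
  forall B : H -> set H, monotone_op ip B -> (forall x, A x `<=` B x) ->
    forall x, B x `<=` A x.

Definition zeros (A : H -> set H) : set H := [set p | A p 0].

(* [y] lies in [(I + s A)^-1 x] iff [x] lies in [y + s A y]. *)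
Definition resolvent_set (A : H -> set H) (s : R) (x : H) : set H :=
  [set y | exists2 v, A y v & x = y + s *: v].

(* For [A] maximal monotone and [0 < s], [resolvent_set A s x] is a singleton
   (Minty), and [resolvent A s x] is its element; the default [0] is then never
   used. *)
Definition resolvent (A : H -> set H) (s : R) (x : H) : H :=
  xget 0 (resolvent_set A s x).

End Operators.

(* Every truncated subtraction [m - 1] below has [1 <= m] when [c] and [D] are
   positive and [C] is positive valued (as it is when it bounds the positive
   sequence [c_n]). *)
Local Open Scope nat_scope.

(* The ceiling of [ln m]; it is a natural number as soon as [1 <= m]. *)
Definition ceil_ln (R : realType) (m : nat) : nat :=
  absz (Num.ceil (ln (m%:R : R)%R)).

Section Functionals.
Variables (R : realType) (c D : nat) (C h l L : nat -> nat).

Definition zeta (j n : nat) : nat := c * (j + 1) * C n - 1.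

Definition sigma_bar (j n : nat) : nat :=
  L (n + ceil_ln R (12 * D ^ 2 * (j + 1))) + 1.

Definition phi2 (j n : nat) (g : nat -> nat) : nat :=
  maxn n (iter (4 * D ^ 2 * (j + 1)) g n).

Definition phi1 (j n : nat) (g : nat -> nat) : nat := g (phi2 j n g).

Definition w (g : nat -> nat) (m : nat) : nat :=
  maxn (g (24 * D * (m + 1) ^ 2)) (24 * D * (m + 1) ^ 2).

Definition beta (j : nat) (g : nat -> nat) : nat :=
  24 * D * (iter (4 * D ^ 4 * (j + 1) ^ 2) (w g) 0 + 1) ^ 2.

Definition r1 (n : nat) : nat := 12 * c * (n + 1) ^ 2 - 1.

Section Mu.
Variables (k : nat) (f : nat -> nat).

Definition f_tilde (n : nat) : nat := f (sigma_bar k n).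

Definition f_tilde2 (n : nat) : nat := f_tilde n + 2.

Definition r2 (n : nat) : nat := maxn (2 * (n + 1)) (128 * D * (k + 1) ^ 2).

Definition r3 (n : nat) : nat :=
  l (maxn (96 * c * D ^ 2 * (n + 1) ^ 2 - 1)
       (maxn (256 * D ^ 2 * (k + 1) ^ 2 - 1) (16 * c * r2 n ^ 2 * D ^ 2))).

Definition r4 (n : nat) : nat :=
  3 * (k + 1) * (f_tilde (phi2 (r1 n) (r3 n) f_tilde2) + 1).

Definition Phi (n : nat) : nat := phi1 (r1 n) (r3 n) f_tilde2.

Definition Xi1 (n : nat) : nat :=
  zeta (2 * (6 * D + 1) * maxn (r1 n) (r4 n) - 1)
       (phi1 (r1 n) (r3 n) f_tilde2).

Definition xi (n : nat) : nat :=
  zeta (maxn (16 * h (f n) * (k + 1) ^ 2 * (6 * D + 1))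
             (4 * c * r2 n ^ 2 * (6 * D + 1)))
       (f n).

Definition Xi2 (n : nat) : nat := xi (Phi n).

Definition Xi (n : nat) : nat := maxn (Xi1 n) (Xi2 n).

Definition mu : nat :=
  let b := beta (32 * (k + 1) ^ 2 - 1) Xi in
  maxn (sigma_bar k (phi2 (r1 b) (r3 b) f_tilde2)) (Phi b).

End Mu.

Definition f_check (k : nat) (f : nat -> nat) (m : nat) : nat :=
  f (maxn m (l (4 * c * D * (k + 1) - 1))).

Definition mu_tilde (k : nat) (f : nat -> nat) : nat :=
  maxn (mu (16 * c ^ 2 * (k + 1) ^ 2 - 1) (fun m => f_check k f m + 1))
       (l (4 * c * D * (k + 1) - 1)).

Variables (E : nat -> nat) (d0 d1 d2 : nat).

Definition Theta (j : nat) : nat :=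
  L (E (3 * j + 2) + ceil_ln R (3 * maxn (2 * d0 + d1) d2 * (j + 1))) + 1.

Definition f_breve (k : nat) (f : nat -> nat) (m : nat) : nat :=
  f (maxn m (Theta (4 * k + 3))).

Definition nu_tilde (k : nat) (f : nat -> nat) : nat :=
  maxn (mu_tilde (2 * k + 1) (f_breve k f)) (Theta (4 * k + 3)).

End Functionals.

(* Main.v *)
Require Import Defs.
From HB Require Import structures.
From mathcomp Require Import all_boot all_order all_algebra sesquilinear.
From mathcomp Require Import all_classical all_reals all_analysis.
From mathcomp Require Import ring lra zify.

Set Implicit Arguments.
Unset Strict Implicit.
Unset Printing Implicit Defensive.

Import Order.TTheory GRing.Theory Num.Theory.
Import numFieldNormedType.Exports.

Local Open Scope classical_set_scope.
Local Open Scope ring_scope.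

(** Why the theorem holds.  Let x be the projection of u onto the zeros of A
    and s_n = |y_n - x|^2.  Firm nonexpansiveness of the resolvents gives

      s_(n+1) + |J_n y_n - y_n|^2 / c
        <= (1 - lambda_n) s_n + 2 lambda_n <u - x, y_(n+1) - x>,

    and <u - x, y - x> is at most about 0 as soon as y is almost a zero of A.
    If s is eventually nonincreasing, it converges, so the displacements
    |J_n y_n - y_n| vanish, the inner products become harmless, and the
    divergence of the series of the lambda_n drives s_n to 0.  If s keeps
    increasing, then at each increase the inequality bounds the displacement
    by a multiple of lambda_n, hence the inner product is harmless there, and
    dividing by lambda_n shows that s_(n+1) itself is small; between two
    increases s only decreases.  In both cases y_n tends to x, so y_(n+1) - y_n
    vanishes and with it J_n y_n - y_n.

    The bounds come from running this argument on finite intervals, for a point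
    x that is only an approximate projection: lemma [approx_projection] finds,
    below the bound beta, a level N and a point x which is a fixed point of
    J = J_(1/c) up to an error chosen as a function of N, and which satisfies
    the variational inequality against all fixed points of J up to 1/(N + 1).
    The displacement of x under J_n costs an additional 4 D |J_n x - x| in the
    recursion ([iteration_inequality]).  The two alternatives become
    [steady_case], where convergence of s is replaced by one long interval on
    which s is almost constant ([metastable_step]), and [ascent_case].  They
    are joined in [mu_metastable] and turned into asymptotic regularity of y in
    [mu_tilde_regular].  The errors e_n are handled separately: z_n - y_n obeys
    a contractive recursion driven by |e_n| and is small from index Theta on
    ([error_rate]).

    All this presupposes that the resolvents of a maximal monotone operator are
    defined everywhere, which is Minty's theorem.  It is obtained by minimising
    over the epigraph of the Fitzpatrick function of the operator
    ([minty_zero]). *)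

(** * The inner product *)

Section InnerProduct.
Context (R : realType) (H : completeNormedModType R) (ip : {dot H for idfun}).
Context (norm_ip : norm_of_dot ip).

Lemma ipC x y : ip x y = ip y x.
Proof. by rewrite (hermitian_subproof x y) expr0 mul1r. Qed.

Lemma ipZl (a : R) x y : ip (a *: x) y = a * ip x y.
Proof. exact: linearZl_LR. Qed.

Lemma ipZr (a : R) x y : ip x (a *: y) = a * ip x y.
Proof. by rewrite ipC ipZl ipC. Qed.

Lemma ipDl x y v : ip (x + y) v = ip x v + ip y v.
Proof. exact: linearDl. Qed.

Lemma ipDr x y v : ip v (x + y) = ip v x + ip v y.
Proof. by rewrite ipC ipDl !(ipC _ v). Qed.

Lemma ipNl x y : ip (- x) y = - ip x y.
Proof. exact: linearNl. Qed.

Lemma ipNr x y : ip x (- y) = - ip x y.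
Proof. by rewrite ipC ipNl ipC. Qed.

Lemma ip0l x : ip 0 x = 0. Proof. exact: linear0l. Qed.

Lemma ip0r x : ip x 0 = 0. Proof. by rewrite ipC ip0l. Qed.

Definition ipE := (ipDl, ipDr, ipNl, ipNr, ip0l, ip0r, ipZl, ipZr).

Lemma ip_ge0 x : 0 <= ip x x.
Proof. by rewrite -norm_ip sqr_ge0. Qed.

Lemma ip_eq0 x : ip x x = 0 -> x = 0.
Proof. by rewrite -norm_ip => /eqP; rewrite sqrf_eq0 normr_eq0 => /eqP. Qed.

Lemma ip_le_norm x y : ip x y <= `|x| * `|y|.
Proof.
have [->|x0] := eqVneq x 0; first by rewrite ip0l normr0 mul0r.
have nx : 0 < `|x| by rewrite normr_gt0.
have := ip_ge0 (`|x| ^+ 2 *: y - ip x y *: x).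
rewrite !ipE (ipC y x) -(norm_ip x) -(norm_ip y) => h.
have h2 : `|x| ^+ 2 * (ip x y ^+ 2) <= `|x| ^+ 2 * ((`|x| * `|y|) ^+ 2) by nra.
move: h2; rewrite ler_pM2l ?exprn_gt0 // => h2.
rewrite (le_trans (ler_norm _)) //.
by rewrite -(ler_pXn2r (n := 2)) ?nnegrE ?mulr_ge0 // real_normK ?num_real.
Qed.

Lemma abs_ip_le x y : `|ip x y| <= `|x| * `|y|.
Proof.
by rewrite ler_norml ip_le_norm andbT lerNl -ipNl -normrN ip_le_norm.
Qed.

(** Reduces an identity between vectors to a ring identity between scalars, see
    the tactic [vec] below. *)
Lemma ip_ext x y : (forall z, ip x z = ip y z) -> x = y.
Proof.
move=> xy; apply/eqP; rewrite -subr_eq0; apply/eqP/ip_eq0.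
by rewrite ipDl ipNl xy subrr.
Qed.
End InnerProduct.

Ltac vec := match goal with norm_ip : norm_of_dot ?ip |- _ =>
  apply: (ip_ext norm_ip) => ?; rewrite ?(ipE ip); ring end.

(** * Minty's theorem *)

Section Minty.
Context (R : realType) (H : completeNormedModType R) (ip : {dot H for idfun})
  (norm_ip : norm_of_dot ip).

Lemma cvg_ip (x y : H) (u : nat -> H) :
  u n @[n --> \oo] --> x -> ip y (u n) @[n --> \oo] --> ip y x.
Proof.
move=> ux; apply/subr_cvg0; apply: norm_cvg0.
apply: (@squeeze_cvgr _ _ _ _ (cst 0) (fun n => `|y| * `|u n - x|)).
- apply: nearW => n /=; rewrite normr_ge0 /= -ipNr -ipDr.
  exact: abs_ip_le.
- exact: cvg_cst.
- rewrite -[X in _ --> X](mulr0 `|y|); apply: cvgMr.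
  by apply/norm_cvg0P/subr_cvg0.
Qed.

(** The epigraph of the Fitzpatrick function of B, that is of the supremum over
    the graph of B of the affine functions <y, v> + <x, w> - <y, w>.  Working
    with the epigraph avoids infinite values. *)
Definition fitzpatrick_epi (B : H -> set H) (x v : H) (t : R) : Prop :=
  forall y w, B y w -> ip y v + ip x w - ip y w <= t.

Definition energy (x v : H) (t : R) : R := t + (`|x| ^+ 2 + `|v| ^+ 2) / 2.

Lemma cauchy_seq_cvg (u : nat -> H) (a : R) :
  (forall N n m, (N <= n)%N -> (N <= m)%N -> `|u n - u m| ^+ 2 <= a / N.+1%:R) ->
  cvgn u.
Proof.
move=> hu; apply/cauchy_cvgP/cauchy_ballP => e e0.
have a0 : 0 <= a.
  by have := hu 0%N 0%N 0%N (leqnn _) (leqnn _); rewrite subrr normr0 expr0n /= divr1.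
pose d := e ^+ 2 / (a + 1).
have a1 : 0 < a + 1 by rewrite ltr_wpDl.
have d0 : 0 < d by rewrite divr_gt0 ?exprn_gt0.
have [N _ hN] := near_infty_natSinv_lt (PosNum d0).
exists (u @` [set n | (N <= n)%N], u @` [set n | (N <= n)%N]).
  by split; exists N => // n Nn; exists n.
move=> [_ _] [/= [n Nn <-] [m Nm <-]]; rewrite -ball_normE /ball_ /=.
rewrite -(ltr_pXn2r (n := 2)) ?nnegrE ?(ltW e0) //.
apply: (le_lt_trans (hu N n m Nn Nm)).
have := hN N (leqnn N); rewrite /= /d ltr_pdivlMr // => h.
apply: le_lt_trans h; rewrite mulrC ler_wpM2l ?invr_ge0 //.
by lra.
Qed.

Lemma parallelogram_mid (x y : H) :
  `|(1/2 : R) *: (x + y)| ^+ 2 = (`|x| ^+ 2 + `|y| ^+ 2) / 2 - `|x - y| ^+ 2 / 4.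
Proof. by rewrite !norm_ip !(ipE ip) (ipC ip y x); field. Qed.

(** The energy is strongly convex in (x, v): by the parallelogram law the midpoint
    of two almost minimal points has a strictly lower energy unless the points are
    close, so that minimising sequences are Cauchy. *)
Lemma energy_minimizer (P : H -> H -> R -> Prop) :
  (exists x v t, P x v t) ->
  (forall x v t, P x v t -> 0 <= energy x v t) ->
  (forall x v t y w s, P x v t -> P y w s ->
     P ((1/2 : R) *: (x + y)) ((1/2 : R) *: (v + w)) ((t + s) / 2)) ->
  (forall (x_ v_ : nat -> H) (t_ : nat -> R) x v t,
     (forall n, P (x_ n) (v_ n) (t_ n)) ->
     x_ n @[n --> \oo] --> x -> v_ n @[n --> \oo] --> v ->
     t_ n @[n --> \oo] --> t -> P x v t) ->
  exists x v t, P x v t /\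
    forall y w s, P y w s -> energy x v t <= energy y w s.
Proof.
move=> [x1 [v1 [t1 P1]]] P0 Pmid Pcl.
pose V := [set a | exists x v t, P x v t /\ a = energy x v t].
have V0 : lbound V 0 by move=> _ [x [v [t [/P0 + ->]]]].
have hV : has_inf V by split; [exists (energy x1 v1 t1), x1, v1, t1|exists 0].
pose I := inf V.
have leI x v t : P x v t -> I <= energy x v t.
  by move=> Pt; apply: ge_inf; [exists 0|exists x, v, t].
have /choice[X hX] n : exists X : H * H * R,
    P X.1.1 X.1.2 X.2 /\ energy X.1.1 X.1.2 X.2 < I + n.+1%:R^-1.
  have n0 : 0 < n.+1%:R^-1 :> R by rewrite invr_gt0.
  have [_ [x [v [t [Pt ->]]]] h] := inf_adherent n0 hV.
  by exists (x, v, t).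
pose x_ n := (X n).1.1; pose v_ n := (X n).1.2; pose t_ n := (X n).2.
have PX n : P (x_ n) (v_ n) (t_ n) by have [] := hX n.
have EX n : energy (x_ n) (v_ n) (t_ n) < I + n.+1%:R^-1 by have [] := hX n.
have key N n m : (N <= n)%N -> (N <= m)%N ->
    `|x_ n - x_ m| ^+ 2 + `|v_ n - v_ m| ^+ 2 <= 8 / N.+1%:R.
  move=> Nn Nm.
  have := leI _ _ _ (Pmid _ _ _ _ _ _ (PX n) (PX m)).
  have := EX n; have := EX m.
  have : n.+1%:R^-1 <= N.+1%:R^-1 :> R by rewrite lef_pV2 ?posrE // ler_nat.
  have : m.+1%:R^-1 <= N.+1%:R^-1 :> R by rewrite lef_pV2 ?posrE // ler_nat.
  rewrite /energy !parallelogram_mid.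
  move: (n.+1%:R^-1) (m.+1%:R^-1) (N.+1%:R^-1) => a b d; lra.
have cx : cvgn x_.
  apply: (@cauchy_seq_cvg _ 8) => N n m Nn Nm.
  by apply: le_trans (key N n m Nn Nm); rewrite lerDl sqr_ge0.
have cv : cvgn v_.
  apply: (@cauchy_seq_cvg _ 8) => N n m Nn Nm.
  by apply: le_trans (key N n m Nn Nm); rewrite lerDr sqr_ge0.
pose x := lim (x_ n @[n --> \oo]); pose v := lim (v_ n @[n --> \oo]).
(* This height makes the energy of the limit equal to the infimum. *)
pose t := I - (`|x| ^+ 2 + `|v| ^+ 2) / 2.
have cE : energy (x_ n) (v_ n) (t_ n) @[n --> \oo] --> I.
  apply: (@squeeze_cvgr _ _ _ _ (cst I) (fun n => I + n.+1%:R^-1)).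
  - by apply: nearW => n; rewrite leI //= ltW.
  - exact: cvg_cst.
  - rewrite -[X in _ --> X]addr0; apply: cvgD; first exact: cvg_cst.
    exact: cvg_harmonic.
have sqn (a : nat -> H) b : a n @[n --> \oo] --> b ->
    `|a n| ^+ 2 @[n --> \oo] --> `|b| ^+ 2.
  by move=> ab; rewrite expr2; under eq_fun do rewrite expr2;
    apply: cvgM; apply: cvg_norm.
have ct : t_ n @[n --> \oo] --> t.
  have -> : t_ = fun n => energy (x_ n) (v_ n) (t_ n)
                    - (`|x_ n| ^+ 2 + `|v_ n| ^+ 2) / 2.
    by apply/funext => n; rewrite /energy addrK.
  apply: cvgB => //; apply: cvgMl; apply: cvgD; exact: sqn.
exists x, v, t; split; first exact: (Pcl x_ v_ t_).
by move=> y w s /leI; rewrite [energy x v t]/energy subrK.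
Qed.

(** The Fitzpatrick function dominates <x, v>, so the energy is nonnegative on its
    epigraph and has a minimiser (x, v, t).  Comparison with the points
    (y, w, <y, w>) over the graph of B shows that (- v, - x) is monotonically
    related to B, hence in its graph; inserting this point in turn gives v = - x. *)
Lemma minty_zero (B : H -> set H) :
  (exists y w, B y w) ->
  (forall x y v w, B x v -> B y w -> 0 <= ip (x - y) (v - w)) ->
  (forall x v, (forall y w, B y w -> 0 <= ip (x - y) (v - w)) -> B x v) ->
  exists x, B x (- x).
Proof.
move=> [y0 [w0 B0]] Bmon Bmax.
pose P := fitzpatrick_epi B.
have PB y w : B y w -> P y w (ip y w).
  by move=> Byw y' w' Byw'; have := Bmon _ _ _ _ Byw Byw'; rewrite !(ipE ip); lra.
have Pip x v t : P x v t -> ip x v <= t.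
  move=> Pt; have [Bxv|nB] := pselect (B x v).
    by have := Pt _ _ Bxv; lra.
  apply: contrapT => nle; apply: nB; apply: Bmax => y w Byw.
  have := Pt _ _ Byw; rewrite !(ipE ip); move: nle => /negP; rewrite -ltNge; lra.
have [] := @energy_minimizer P.
- by exists y0, w0, (ip y0 w0); exact: PB.
- move=> x v t /Pip; rewrite /energy !norm_ip.
  by have := ip_ge0 norm_ip (x + v); rewrite !(ipE ip) (ipC ip v x); lra.
- move=> x v t y w s Pt Ps y' w' Byw.
  by have := Pt _ _ Byw; have := Ps _ _ Byw; rewrite !(ipE ip); lra.
- move=> x_ v_ t_ x v t PX cx cv ct y w Byw.
  have c1 : (ip y (v_ n) + ip (x_ n) w - ip y w) @[n --> \oo] -->
      (ip y v + ip x w - ip y w).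
    apply: cvgB; last exact: cvg_cst.
    apply: cvgD; first exact: cvg_ip.
    by rewrite ipC; under eq_fun do rewrite ipC; exact: cvg_ip.
  by apply: (ler_cvg_to c1 ct); apply: nearW => n; exact: PX.
move=> x [v [t [Pt tmin]]].
(* First order optimality at the minimiser in the direction of (y, w, <y, w>). *)
have opt y w : B y w -> t + ip x x + ip v v <= ip y w + ip x y + ip v w.
  move=> Byw; pose a := ip x x + ip v v; pose b := ip y y + ip w w.
  pose m := ip x y + ip v w.
  rewrite leNgt; apply/negP => h.
  pose dd := t + a - ip y w - m.
  have dd0 : 0 < dd by rewrite /dd /a /m; lra.
  have a0 : 0 <= a by rewrite addr_ge0 // ip_ge0.
  have b0 : 0 <= b by rewrite addr_ge0 // ip_ge0.
  have ab0 : 0 <= a + b - 2 * m.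
    by have := ip_ge0 norm_ip (x - y); have := ip_ge0 norm_ip (v - w);
      rewrite !(ipE ip) (ipC ip y x) (ipC ip w v) /a /b /m; lra.
  (* If optimality failed by dd, a step of length s in that direction would
     decrease the energy by at least s * dd / 2. *)
  pose s := dd / (dd + (a + b - 2 * m)).
  have den0 : 0 < dd + (a + b - 2 * m) by lra.
  have s0 : 0 < s by rewrite divr_gt0.
  have s1 : s <= 1 by rewrite ler_pdivrMr //; lra.
  have sE : s * (dd + (a + b - 2 * m)) = dd by rewrite divfK ?gt_eqF.
  have := tmin ((1 - s) *: x + s *: y) ((1 - s) *: v + s *: w)
               ((1 - s) * t + s * ip y w).
  have -> : energy ((1 - s) *: x + s *: y) ((1 - s) *: v + s *: w)
      ((1 - s) * t + s * ip y w) = energy x v t - s * dd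
        + s ^+ 2 * (a + b - 2 * m) / 2.
    rewrite /energy !norm_ip !(ipE ip) (ipC ip y x) (ipC ip w v) /dd /a /b /m.
    by field.
  have /[swap]/[apply] :  P ((1 - s) *: x + s *: y) ((1 - s) *: v + s *: w)
      ((1 - s) * t + s * ip y w).
    move=> y' w' Byw'; have := Pt _ _ Byw'; have := PB _ _ Byw _ _ Byw'.
    by rewrite !(ipE ip) => h1 h2; nra.
  by nra.
have Bvx : B (- v) (- x).
  apply: Bmax => y w Byw; have := opt _ _ Byw; have := Pip _ _ _ Pt.
  have := ip_ge0 norm_ip (x + v).
  rewrite !(ipE ip) !(ipC ip v x) (ipC ip y x); lra.
have vx : x + v = 0.
  apply: (ip_eq0 norm_ip); apply: le_anti; rewrite ip_ge0 // andbT.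
  have := opt _ _ Bvx; have := Pip _ _ _ Pt.
  by rewrite !(ipE ip) !(ipC ip v x); lra.
exists x; move: Bvx; have -> : - v = x by apply/eqP; rewrite eq_sym -addr_eq0 vx.
by [].
Qed.
End Minty.

(** * Resolvents *)

Section Resolvent.
Context (R : realType) (H : completeNormedModType R) (ip : {dot H for idfun})
  (norm_ip : norm_of_dot ip) (A : H -> set H)
  (A_maxmon : maximal_monotone ip A) (A_zero : zeros A !=set0).


Local Notation J := (resolvent A).

(** Maximality in the form in which it is used: the pair (x, v) can be added to the
    graph without destroying monotonicity. *)
Lemma maximal_monotone_mem x v :
  (forall y w, A y w -> 0 <= ip (x - y) (v - w)) -> A x v.
Proof.
move=> xv; have [Amon Amax] := A_maxmon.
pose B y := A y `|` [set w | y = x /\ w = v].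
apply: (Amax B); last by right.
- move=> y z w w' [Ayw|[-> ->]] [Azw|[-> ->]].
  + exact: Amon.
  + by rewrite -opprB -(opprB v) ipNl ipNr opprK; exact: xv.
  + exact: xv.
  + by rewrite subrr ip0l.
- by move=> y w; left.
Qed.

(** This is where Minty's theorem enters: a solution of 0 = y + s *: v - x with v in
    A y is a zero of the identity plus the operator y |-> s *: A y - x. *)
Lemma resolventP (s : R) x : 0 < s -> A (J s x) (s^-1 *: (x - J s x)).
Proof.
move=> s0; have [Amon _] := A_maxmon.
have [y [v Ayv xE]] : exists y, resolvent_set A s x y.
  pose B y := [set w | exists2 v, A y v & w = s *: v - x].
  have [|||y [v Ayv yE]] := @minty_zero _ _ _ norm_ip B.
  - by have [p Ap] := A_zero; exists p, (s *: 0 - x), 0.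
  - move=> y z w w' [v Ayv ->] [v' Azv' ->].
    have -> : s *: v - x - (s *: v' - x) = s *: (v - v') by vec.
    rewrite ipZr.
    by rewrite mulr_ge0 ?(ltW s0) //; exact: Amon.
  - move=> y w yw; exists (s^-1 *: (w + x)); last first.
      by rewrite scalerA mulfV ?gt_eqF // scale1r addrK.
    apply: maximal_monotone_mem => z v Azv.
    have -> : s^-1 *: (w + x) - v = s^-1 *: (w - (s *: v - x)).
      by rewrite opprB addrA !scalerBr scalerA mulVf ?gt_eqF // scale1r.
    by rewrite ipZr mulr_ge0 ?invr_ge0 ?(ltW s0) // yw //; exists v.
  exists y, v => //; have -> : x = s *: v - (s *: v - x) by vec.
  by rewrite -yE; vec.
have : resolvent_set A s x (J s x) by apply: (@xgetI _ 0 _ y); exists v.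
case=> w Aw {2}->; rewrite [_ + _ *: w]addrC addrK scalerA mulVf ?gt_eqF //.
by rewrite scale1r.
Qed.

Lemma resolvent_firm (s : R) x y : 0 < s ->
  0 <= ip (J s x - J s y) ((x - J s x) - (y - J s y)).
Proof.
move=> s0; have [Amon _] := A_maxmon.
have := Amon _ _ _ _ (resolventP x s0) (resolventP y s0).
by rewrite -scalerBr ipZr pmulr_rge0 ?invr_gt0.
Qed.

Lemma resolvent_zero (s : R) p : 0 < s -> zeros A p -> J s p = p.
Proof.
move=> s0 Ap; have [Amon _] := A_maxmon.
have := Amon _ _ _ _ (resolventP p s0) Ap.
rewrite subr0 ipZr pmulr_rge0 ?invr_gt0 // -opprB ipNl oppr_ge0 => h.
apply/eqP; rewrite eq_sym -subr_eq0; apply/eqP/(ip_eq0 norm_ip).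
by apply: le_anti; rewrite h ip_ge0.
Qed.

Lemma resolvent_nonexpansive (s : R) x y : 0 < s ->
  `|J s x - J s y| <= `|x - y|.
Proof.
move=> s0; have := resolvent_firm x y s0.
set d := J s x - J s y.
have -> : x - J s x - (y - J s y) = (x - y) - d.
  by rewrite /d; vec.
rewrite ipDr ipNr subr_ge0 -norm_ip => h.
have [->|d0] := eqVneq d 0; first by rewrite normr0.
rewrite -(ler_pM2l (x := `|d|)) ?normr_gt0 // -expr2.
exact: le_trans h (ip_le_norm _ _ _).
Qed.

(** Compares resolvents with different parameters: the displacement grows with the
    parameter, its quotient by the parameter decreases.  Both follow from one
    application of monotonicity, which after Cauchy-Schwarz factors as
    (t |a| - s |b|) (|b| - |a|) >= 0 for the two displacements a and b. *)
Lemma resolvent_parameter (s t : R) x : 0 < s -> s <= t ->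
  `|x - J s x| <= `|x - J t x| /\ s * `|x - J t x| <= t * `|x - J s x|.
Proof.
move=> s0 st; have t0 := lt_le_trans s0 st; have [Amon _] := A_maxmon.
have := Amon _ _ _ _ (resolventP x s0) (resolventP x t0).
set a := x - J s x; set b := x - J t x.
have -> : J s x - J t x = b - a.
  by rewrite /a /b; vec.
have := ip_le_norm norm_ip a b.
have [a0 b0] := (normr_ge0 a, normr_ge0 b); move=> ab h.
have : 0 <= s * t * ip (b - a) (s^-1 *: a - t^-1 *: b).
  by rewrite mulr_ge0 // mulr_ge0 ?(ltW s0) ?(ltW t0).
have -> : s * t * ip (b - a) (s^-1 *: a - t^-1 *: b) =
    (t + s) * ip a b - s * `|b| ^+ 2 - t * `|a| ^+ 2.
  by clearbody a b; rewrite !norm_ip !(ipE ip) (ipC ip b a); field; rewrite !gt_eqF.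
move=> {}h.
have key : 0 <= (t * `|a| - s * `|b|) * (`|b| - `|a|) by nra.
move: key a0 b0; move: (`|a|) (`|b|) => na nb key a0 b0.
split; rewrite leNgt; apply/negP => lt.
  have : s * nb < t * na by apply: lt_le_trans (ler_wpM2r a0 st); rewrite ltr_pM2l.
  by move=> ?; nra.
have : na < nb by rewrite -(ltr_pM2l s0); apply: le_lt_trans lt; rewrite ler_wpM2r.
by move=> ?; nra.
Qed.

(** Twice the resolvent minus the identity is nonexpansive.  Applied at a zero p this
    gives a bound for the factor occurring in [resolvent_firm_perturbed]. *)
Lemma resolvent_reflect (s : R) x p : 0 < s -> zeros A p ->
  `|2 *: J s x - x - p| <= `|x - p|.
Proof.
move=> s0 Ap; have := resolvent_firm x p s0; rewrite (resolvent_zero s0 Ap).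
rewrite subrr subr0.
rewrite -(ler_pXn2r (n := 2) _ (x := `|2 *: _ - _ - _|)) ?nnegrE // !norm_ip.
move: (J s x) => j.
have -> : x - p = (x - j) + (j - p) by vec.
have -> : 2 *: j - x - p = (j - p) - (x - j) by vec.
move: (x - j) (j - p) => a b; rewrite !(ipE ip) (ipC ip b a); lra.
Qed.

(** When x is only almost fixed, firm nonexpansiveness loses a cross term between the
    displacement of x and the vector from x to the reflection of y. *)
Lemma resolvent_firm_perturbed (s : R) x y : 0 < s ->
  `|J s y - x| ^+ 2 <= `|y - x| ^+ 2 - `|J s y - y| ^+ 2
    + 2 * `|J s x - x| * `|2 *: J s y - y - x|.
Proof.
move=> s0; have := resolvent_firm y x s0.
move: (J s y) (J s x) => j q h.
have := ip_le_norm norm_ip (q - x) (2 *: j - y - x).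
have := ip_ge0 norm_ip (q - x).
have : 0 <= ip ((j - x) - (q - x)) ((y - j) + (q - x)).
  suff -> : ip ((j - x) - (q - x)) ((y - j) + (q - x)) =
    ip (j - q) (y - j - (x - q)) by [].
  by congr (ip _ _); vec.
rewrite !norm_ip.
have -> : 2 *: j - y - x = (j - x) - (y - j) by vec.
have -> : y - x = (y - j) + (j - x) by vec.
have -> : j - y = - (y - j) by vec.
move: (j - x) (y - j) (q - x) => b a e.
rewrite !(ipE ip) !opprK ?(ipC ip b a) ?(ipC ip b e) ?(ipC ip a e); lra.
Qed.

(** The fixed point set of a nonexpansive map is convex; this is the version with
    errors.  It rests on the identity expressing |q - z|^2, for z on the segment
    from x to y, by |q - x|^2, |q - y|^2 and |x - y|^2. *)
Lemma nonexpansive_convex (T : H -> H) (x y z : H) (t d : R) :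
  (forall a b, `|T a - T b| <= `|a - b|) ->
  0 <= t <= 1 -> `|T x - x| <= d -> `|T y - y| <= d ->
  z = (1 - t) *: x + t *: y ->
  `|T z - z| ^+ 2 <= d ^+ 2 + d * `|x - y|.
Proof.
move=> Tne /andP[t0 t1] dx dy zE; have d0 := le_trans (normr_ge0 _) dx.
have hx : `|T z - x| <= t * `|x - y| + d.
  have -> : T z - x = (T z - T x) + (T x - x) by vec.
  apply: le_trans (ler_normD _ _) (lerD _ dx); apply: le_trans (Tne _ _) _.
  have -> : z - x = - (t *: (x - y)) by rewrite zE; vec.
  by rewrite normrN normrZ ger0_norm.
have hy : `|T z - y| <= (1 - t) * `|x - y| + d.
  have -> : T z - y = (T z - T y) + (T y - y) by vec.
  apply: le_trans (ler_normD _ _) (lerD _ dy); apply: le_trans (Tne _ _) _.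
  have -> : z - y = (1 - t) *: (x - y) by rewrite zE; vec.
  by rewrite normrZ ger0_norm // subr_ge0.
have -> : `|T z - z| ^+ 2 = (1 - t) * `|T z - x| ^+ 2 + t * `|T z - y| ^+ 2
    - t * (1 - t) * `|x - y| ^+ 2.
  move: (T z) => q; rewrite zE !norm_ip !(ipE ip).
  by rewrite (ipC ip y x) (ipC ip x q) (ipC ip y q); ring.
have sx : `|T z - x| ^+ 2 <= (t * `|x - y| + d) ^+ 2.
  by rewrite lerXn2r ?nnegrE ?addr_ge0 ?mulr_ge0.
have sy : `|T z - y| ^+ 2 <= ((1 - t) * `|x - y| + d) ^+ 2.
  by rewrite lerXn2r ?nnegrE ?addr_ge0 ?mulr_ge0 ?subr_ge0.
have := ler_wpM2l t0 sy.
have t1' : 0 <= 1 - t by rewrite subr_ge0.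
have := ler_wpM2l t1' sx.
have : 0 <= d * `|x - y| * (1 - 2 * t) ^+ 2.
  by apply: mulr_ge0; rewrite ?sqr_ge0 ?mulr_ge0.
by lra.
Qed.
End Resolvent.

(** * Approximate projection onto the fixed point set *)

Section ApproximateProjection.
Context (R : realType) (H : completeNormedModType R) (ip : {dot H for idfun})
  (norm_ip : norm_of_dot ip).


Context (T : H -> H) (T_ne : forall a b, `|T a - T b| <= `|a - b|)
  (p : H) (Tp : T p = p) (u : H) (D : nat).

(** Start at the exact fixed point p with the strictest tolerance.  As long as the
    claim fails, move to a point that is closer to u by eps (in squared distance)
    at the price of one application of W in the tolerance.  The squared distance
    is nonnegative, so fewer than n moves are possible. *)
Lemma near_minimizer (W : nat -> nat) (eps : R) (n : nat) :
  (forall m, (m <= W m)%N) -> `|u - p| ^+ 2 < eps *+ n ->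
  exists m x, [/\ (m <= iter n W 0)%N, `|x - p| <= D%:R,
    `|T x - x| <= (W m).+1%:R^-1 &
    forall y, `|y - p| <= D%:R -> `|T y - y| <= m.+1%:R^-1 ->
      `|u - x| ^+ 2 <= `|u - y| ^+ 2 + eps].
Proof.
move=> Winf lt; apply: contrapT => none.
have itW i : (i <= n)%N -> (iter i W 0 <= iter n W 0)%N.
  move=> /subnK <-; elim: (n - i)%N => //= m IH.
  exact: leq_trans IH (Winf _).
have : forall i, (i <= n)%N -> exists x, [/\ `|x - p| <= D%:R,
    `|T x - x| <= (iter (n - i) W 0).+1%:R^-1 &
    `|u - x| ^+ 2 <= `|u - p| ^+ 2 - eps *+ i].
  elim=> [_|i IH lti].
    by exists p; rewrite Tp !subrr normr0 mulr0n subr0 ler0n invr_ge0 ler0n.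
  have [x [xp Tx ux]] := IH (ltnW lti).
  apply: contrapT => nox; apply: none; exists (iter (n - i.+1) W 0), x; split.
  - by apply: itW; rewrite leq_subr.
  - by [].
  - by move: Tx; rewrite -(subnSK lti).
  - move=> y yp Ty; rewrite leNgt; apply/negP => ly; apply: nox; exists y.
    by split=> //; move: ux ly; rewrite mulrS; lra.
move=> /(_ n (leqnn n))[x [_ _]].
have : 0 <= `|u - x| ^+ 2 by rewrite sqr_ge0.
by move: lt; lra.
Qed.

Context (D_pos : (0 < D)%N) (uD : 2 * `|u - p| <= D%:R).

(** If x almost minimises the distance to u among almost fixed points, compare it
    with the point z = (1 - t) x + t y: this gives
    2 t <u - x, y - x> <= t^2 |y - x|^2 + eps.  The choices
    eps = 1/(4 D^2 (j+1)^2) and t = 1/(4 D^2 (j+1)) make both terms on the right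
    equal to t/(j+1).  The level N is large enough for z to be fixed up to
    1/(n + 1) whenever x and y are fixed up to 1/(N + 1). *)
Lemma approx_projection (j : nat) (g : nat -> nat) :
  exists N x, [/\ (N <= beta D j g)%N, `|x - p| <= D%:R,
    `|T x - x| <= (g N).+1%:R^-1 &
    forall y, `|y - p| <= D%:R -> `|T y - y| <= N.+1%:R^-1 ->
      ip (u - x) (y - x) <= j.+1%:R^-1].
Proof.
have D1 : 1 <= D%:R :> R by rewrite ler1n.
have uD' := uD; set a : R := D%:R in uD' D1 *; set b : R := j.+1%:R.
have b0 : 0 < b by rewrite ltr0n.
have a0 : 0 < a by lra.
pose eps := (4 * a ^+ 2 * b ^+ 2)^-1.
have e0 : 0 < eps by rewrite invr_gt0 !mulr_gt0 ?exprn_gt0.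
have winf m : (m <= w D g m)%N by rewrite /w; nia.
have lt : `|u - p| ^+ 2 < eps *+ (4 * D ^ 4 * (j + 1) ^ 2).
  have -> : eps *+ (4 * D ^ 4 * (j + 1) ^ 2) = a ^+ 2.
    rewrite -mulr_natl natrM natrX natrM natrX addn1 -/a -/b /eps; field.
    by rewrite !gt_eqF.
  rewrite -subr_gt0; have := normr_ge0 (u - p); nra.
have [n [x [nle xp Tx xmin]]] := near_minimizer winf lt.
pose N := (24 * D * (n + 1) ^ 2)%N.
exists N, x; split => //.
- by rewrite /N /beta leq_mul2l leq_sqr leq_add2r nle orbT.
- apply: (le_trans Tx); rewrite lef_pV2 ?posrE ?ltr0n // ler_nat ltnS.
  by rewrite /w -/N leq_maxl.
move=> y yp Ty; pose t := (4 * a ^+ 2 * b)^-1.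
have t0 : 0 < t by rewrite invr_gt0 !mulr_gt0 ?exprn_gt0.
have b1 : 1 <= b by rewrite ler1n.
have t1 : t <= 1 by rewrite invf_le1 ?mulr_gt0 ?exprn_gt0 //; nra.
have t01 : 0 <= t <= 1 by rewrite ltW.
pose z := (1 - t) *: x + t *: y.
have xy : `|x - y| <= 2 * a.
  have -> : x - y = (x - p) - (y - p) by vec.
  by have := ler_normB (x - p) (y - p); move: xp yp; rewrite -/a; lra.
have TxN : `|T x - x| <= N.+1%:R^-1.
  apply: (le_trans Tx); rewrite lef_pV2 ?posrE ?ltr0n // ler_nat ltnS.
  by rewrite /w -/N leq_maxr.
have zp : `|z - p| <= a.
  have -> : z - p = (1 - t) *: (x - p) + t *: (y - p) by rewrite /z; vec.
  apply: le_trans (ler_normD _ _) _; rewrite !normrZ !ger0_norm ?subr_ge0 ?(ltW t0) //.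
  move: xp yp; rewrite -/a => xp yp.
  have := ler_wpM2l (ltW t0) yp; have t1' : 0 <= 1 - t by rewrite subr_ge0.
  have := ler_wpM2l t1' xp; lra.
have Tz : `|T z - z| <= n.+1%:R^-1.
  rewrite -(ler_pXn2r (n := 2)) ?nnegrE ?invr_ge0 ?ler0n //.
  apply: le_trans (nonexpansive_convex norm_ip T_ne t01 TxN Ty erefl) _.
  set d : R := N.+1%:R^-1; set c : R := n.+1%:R.
  have c1 : 1 <= c by rewrite ler1n.
  have d0 : 0 <= d by rewrite invr_ge0 ler0n.
  have dc : d * (24 * a * c ^+ 2) <= 1.
    rewrite /d mulrC ler_pdivrMr ?ltr0n // mul1r /c /a -natrX -!natrM ler_nat /N addn1.
    exact: leqnSn.
  have d1 : d <= 1 by rewrite invf_le1 ?ler1n ?ltr0n.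
  have -> : c^-1 ^+ 2 = 1 / c ^+ 2 by rewrite exprVn mul1r.
  have c2 : 0 < c ^+ 2 by apply: exprn_gt0; lra.
  rewrite (ler_pdivlMr _ _ c2).
  have h1 : d ^+ 2 + d * `|x - y| <= 3 * a * d by nra.
  have := ler_wpM2r (sqr_ge0 c) h1; nra.
have := xmin z zp Tz.
have -> : u - z = (u - x) - t *: (y - x) by rewrite /z; vec.
rewrite !norm_ip.
have : ip (y - x) (y - x) <= (2 * a) ^+ 2.
  by rewrite -norm_ip -normrN opprB lerXn2r ?nnegrE ?mulr_ge0 ?(ltW a0).
move: (u - x) (y - x) => v e; rewrite !(ipE ip) (ipC ip e v) => he h.
have {}h : 2 * t * ip v e <= t ^+ 2 * ip e e + eps by lra.
have h2 : 2 * t * ip v e <= 2 * t * b^-1.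
  apply: (le_trans h); apply: (@le_trans _ _ (t ^+ 2 * (2 * a) ^+ 2 + eps)).
    by rewrite lerD2r ler_wpM2l ?sqr_ge0.
  rewrite le_eqVlt; apply/orP; left; apply/eqP; rewrite /t /eps; field.
  by rewrite !gt_eqF.
by rewrite -(ler_pM2l (x := 2 * t)) // mulr_gt0.
Qed.
End ApproximateProjection.

(** * Iterating monotone functions *)

Lemma monotone_leq (g : nat -> nat) m n :
  monotone_fun g -> (m <= n)%N -> (g m <= g n)%N.
Proof.
by move=> gm mn; apply: (@homo_leq _ g leq) mn; [exact: leqnn|exact: leq_trans|].
Qed.

Lemma monotone_iter (g : nat -> nat) i m n :
  monotone_fun g -> (m <= n)%N -> (iter i g m <= iter i g n)%N.
Proof. by move=> gm mn; elim: i => //= i; exact: monotone_leq. Qed.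

Lemma monotone_comp (g h : nat -> nat) :
  monotone_fun g -> monotone_fun h -> monotone_fun (fun n => g (h n)).
Proof. by move=> gm hm n; apply: monotone_leq. Qed.

Lemma iter_ascending (g : nat -> nat) n i j : monotone_fun g -> (n <= g n)%N ->
  (i <= j)%N -> (iter i g n <= iter j g n)%N.
Proof.
move=> gm ng /subnK <-; elim: (j - i)%N => //= k /leq_trans; apply.
by rewrite -iterS iterSr monotone_iter.
Qed.

Lemma iter_descending (g : nat -> nat) n i : monotone_fun g -> (g n <= n)%N ->
  (iter i g n <= n)%N.
Proof.
move=> gm gn; elim: i => //= i IH; exact: leq_trans (monotone_leq gm IH) gn.
Qed.

(** A monotone function need not lie above the identity, so its iterates at n either
    increase or stay below n. *)
Lemma iter_le_max (g : nat -> nat) n i j : monotone_fun g -> (i <= j)%N ->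
  (iter i g n <= maxn n (iter j g n))%N.
Proof.
move=> gm ij; rewrite leq_max; have [gn|/ltnW ng] := leqP (g n) n.
  by rewrite iter_descending.
by rewrite [X in _ || X]iter_ascending ?orbT.
Qed.

Lemma phi2_mono D g j j' n n' : monotone_fun g -> (j <= j')%N -> (n <= n')%N ->
  (phi2 D j n g <= phi2 D j' n' g)%N.
Proof.
move=> gm jj nn; rewrite /phi2 geq_max (leq_trans nn) ?leq_maxl //=.
apply: leq_trans (monotone_iter _ gm nn) _; apply: iter_le_max => //.
by rewrite leq_mul2l leq_add2r jj orbT.
Qed.

(** * Real sequences *)

Section RealSequences.
Context (R : realType).

(** Metastability of bounded nonincreasing sequences, by telescoping: if all J steps
    from one iterate of g to the next lost more than d, then s would become
    negative. *)
Lemma metastable_step (s : nat -> R) (g : nat -> nat) (n J : nat) (d : R) :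
  monotone_fun g -> (forall i, 0 <= s i) -> (0 < J)%N -> s n <= d *+ J ->
  exists m, [/\ (n <= m)%N, (m <= maxn n (iter J g n))%N &
    (m <= g m)%N -> s m - s (g m) <= d].
Proof.
move=> gm s0 J0 sn; have [gn|ng] := ltnP (g n) n.
  by exists n; rewrite leqnn leq_maxl; split => //; rewrite leqNgt gn.
apply: contrapT => none.
have : forall i, (0 < i)%N -> (i <= J)%N -> s (iter i g n) < s n - d *+ i.
  elim=> // i IH _ iJ.
  have lt : d < s (iter i g n) - s (iter i.+1 g n).
    rewrite ltNge; apply/negP => le; apply: none; exists (iter i g n); split=> //.
    - by have := iter_ascending gm ng (leq0n i).
    - by apply: iter_le_max => //; exact: ltnW.
  move: IH lt; case: i iJ => [|i] iJ IH lt.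
    by rewrite mulr1n; move: lt => /=; lra.
  by have := IH isT (ltnW iJ); rewrite (mulrS _ i.+1); lra.
move=> /(_ J J0 (leqnn J)); have := s0 (iter J g n); lra.
Qed.

Lemma contraction_rec_bound (s la er : nat -> R) (b : R) (m i : nat) :
  (forall j, 0 <= la j <= 1) -> (forall j, 0 <= er j) -> 0 <= b ->
  (m <= i)%N ->
  (forall j, (m <= j < i)%N -> s j.+1 <= (1 - la j) * s j + la j * b + er j) ->
  s i <= (\prod_(m <= j < i) (1 - la j)) * s m + b + \sum_(m <= j < i) er j.
Proof.
move=> la01 er0 b0 /subnK <-; elim: (i - m)%N => [|k IH] hs.
  by rewrite !big_geq // mul1r addr0 lerDl.
have {}IH : s (k + m)%N <= (\prod_(m <= j < k + m) (1 - la j)) * s m + b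
    + \sum_(m <= j < k + m) er j.
  by apply: IH => j /andP[mj jk]; apply: hs; rewrite mj ltnW.
rewrite addSn !big_nat_recr ?leq_addl //=.
have /hs : (m <= k + m < k.+1 + m)%N by rewrite leq_addl /= addSn ltnS.
have S0 : 0 <= \sum_(m <= j < k + m) er j by apply: sumr_ge0 => j _.
have /andP[l0 l1] := la01 (k + m)%N.
have h : 0 <= 1 - la (k + m)%N by lra.
have := ler_wpM2l h IH; have := mulr_ge0 l0 S0.
move: (\prod_(_ <= _ < _) _) (\sum_(_ <= _ < _) _) => p q; lra.
Qed.

Section Divergence.
Context (la : nat -> R) (L : nat -> nat)
  (la01 : forall n, 0 < la n < 1)
  (L_div : forall k, k%:R <= \sum_(1 <= i < (L k).+1) la i).

Lemma rate_ge k : (k <= L k)%N.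
Proof.
rewrite -(ler_nat R); apply: le_trans (L_div k) _.
apply: (@le_trans _ _ (\sum_(1 <= i < (L k).+1) 1)).
  by apply: ler_sum => i _; have /andP[_ /ltW] := la01 i.
by rewrite sumr_const_nat subSS subn0.
Qed.

(** Since la is below 1, the first m terms of the series contribute at most m; this is
    why the rate is evaluated at m + K. *)
Lemma sum_tail_ge m m0 K i : (m0 <= m.+1)%N -> (L (m + K) < i)%N ->
  K%:R <= \sum_(m0 <= j < i) la j.
Proof.
move=> m0m Li; have la0 j : 0 <= la j by have /andP[/ltW] := la01 j.
have mL : (m < (L (m + K)).+1)%N.
  by rewrite ltnS; apply: leq_trans (leq_addr K m) (rate_ge _).
have mi : (m < i)%N by apply: leq_trans Li; exact: mL.
rewrite (big_cat_nat (n := m.+1)) //=.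
rewrite [X in _ + X](big_cat_nat (n := (L (m + K)).+1)) //=.
have := L_div (m + K).
rewrite (big_cat_nat (n := m.+1)) //= natrD.
have : \sum_(1 <= j < m.+1) la j <= m%:R.
  apply: (@le_trans _ _ (\sum_(1 <= i < m.+1) 1)).
    by apply: ler_sum => j _; have /andP[_ /ltW] := la01 j.
  by rewrite sumr_const_nat subSS subn0.
have : 0 <= \sum_(m0 <= j < m.+1) la j by apply: sumr_ge0.
have : 0 <= \sum_((L (m + K)).+1 <= j < i) la j by apply: sumr_ge0.
lra.
Qed.

Lemma expR_ceil_ln (X : nat) : (0 < X)%N -> expR (- (ceil_ln R X)%:R) <= X%:R^-1 :> R.
Proof.
move=> X0; rewrite expRN lef_pV2 ?posrE ?expR_gt0 ?ltr0n //.
rewrite -[X in X <= _](@lnK R) ?posrE ?ltr0n // ler_expR.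
apply: le_trans (ceil_ge _) _; rewrite /ceil_ln.
have /gez0_abs {1}<- // : 0 <= Num.ceil (ln (X%:R : R)).
by rewrite ceil_ge0 (lt_le_trans (ltrN10 _)) // ln_ge0 // ler1n.
Qed.

Lemma prod_tail_le m m0 (X i : nat) : (0 < X)%N -> (m0 <= m.+1)%N ->
  (L (m + ceil_ln R X) < i)%N -> \prod_(m0 <= j < i) (1 - la j) <= X%:R^-1.
Proof.
move=> X0 m0m Li; apply: le_trans (expR_ceil_ln X0).
apply: (@le_trans _ _ (expR (- \sum_(m0 <= j < i) la j))); last first.
  by rewrite ler_expR lerN2; apply: sum_tail_ge Li.
rewrite -sumrN expR_sum; apply: ler_prod => j _.
by rewrite subr_ge0 (ltW (andP (la01 j)).2) /= expR_ge1Dx.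
Qed.

Lemma prod_contraction_ge0 m i : 0 <= \prod_(m <= j < i) (1 - la j).
Proof.
by apply: prodr_ge0 => j _; rewrite subr_ge0; have /andP[_ /ltW] := la01 j.
Qed.
End Divergence.
End RealSequences.

(** * Scalar estimates *)

(** Throughout this part a is a bound for distances, la one of the step sizes, e the
    displacement of the reference point, s and s' are consecutive squared distances
    to it, b is the inner product in the recursion and rho the squared displacement
    of the iterate (in [ascent_value_small] the displacement itself). *)

(** Here s - s' is small by assumption, so the recursion bounds rho. *)
Lemma small_displacement_steady (R : realFieldType) (c a N la e r s s' b rho : R) :
  1 <= c -> 1 <= a -> 1 <= N -> 0 <= la -> 0 <= e -> 0 <= s ->
  la * (96 * c * a ^+ 2 * N ^+ 2) <= 1 -> 11 * c * N ^+ 2 <= r ->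
  e * (2 * (6 * a + 1) * r) <= 1 -> (s - s') * (12 * c * N ^+ 2) <= 1 ->
  b <= 3 * a ^+ 2 ->
  rho <= c * ((1 - la) * s - s' + 2 * la * b + 4 * a * e) ->
  rho * N ^+ 2 <= 1.
Proof.
move=> c1 a1 N1 la0 e0 s0 hla hr he hs hb hrho.
have N2 : 0 <= N ^+ 2 by rewrite sqr_ge0.
have cN : 0 <= c * N ^+ 2 by apply: mulr_ge0 => //; lra.
have lb : la * b <= la * (3 * a ^+ 2) by rewrite ler_wpM2l.
have ls : 0 <= la * s by rewrite mulr_ge0.
have h : rho * N ^+ 2 <= c * N ^+ 2 * (s - s' + 6 * a ^+ 2 * la + 4 * a * e).
  apply: le_trans (ler_wpM2r N2 hrho) _.
  rewrite mulrAC -subr_ge0 -mulrBr mulr_ge0 //; lra.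
have he' : e * (2 * (6 * a) * (11 * c * N ^+ 2)) <= 1.
  apply: le_trans he; rewrite ler_wpM2l //; apply: ler_pM; lra.
lra.
Qed.

(** The error is chosen relative to a lower bound 1/hh of the step size, so that it
    stays small after division by the step size. *)
Lemma error_le_step (R : realFieldType) (a q la e hh : R) :
  1 <= a -> 1 <= q -> 0 <= e -> 1 <= la * hh -> 0 <= la -> 0 <= hh ->
  e * (16 * hh * q ^+ 2 * (6 * a + 1)) <= 1 -> 96 * a * e * q ^+ 2 <= la.
Proof.
move=> a1 q1 e0 hh1 la0 hh0 he; have q2 : 0 <= q ^+ 2 by rewrite sqr_ge0.
have h1 : 0 <= e * (a * q ^+ 2) by rewrite mulr_ge0 // mulr_ge0 //; lra.
have h0 : 0 <= e * (hh * q ^+ 2) by rewrite mulr_ge0 // mulr_ge0.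
have h2 : e * (a * q ^+ 2) <= la * hh * (e * (a * q ^+ 2)) by rewrite ler_peMl.
have h3 : e * (96 * hh * q ^+ 2 * a) <= 1 by lra.
by have := ler_wpM2l la0 h3; lra.
Qed.

(** Here s does not decrease, so rho is controlled by the step size alone. *)
Lemma small_displacement_ascent (R : realFieldType) (c a N la e s s' b rho : R) :
  1 <= c -> 1 <= a -> 0 <= la -> 0 <= e -> 0 <= s -> s <= s' ->
  la * (16 * c * N ^+ 2 * a ^+ 2) <= 1 -> 96 * a * e <= la -> b <= 3 * a ^+ 2 ->
  rho <= c * ((1 - la) * s - s' + 2 * la * b + 4 * a * e) ->
  rho * N ^+ 2 <= 1.
Proof.
move=> c1 a1 la0 e0 s0 ss hla he hb hrho.
have N2 : 0 <= N ^+ 2 by rewrite sqr_ge0.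
have cN : 0 <= c * N ^+ 2 by apply: mulr_ge0 => //; lra.
have lb : la * b <= la * (3 * a ^+ 2) by rewrite ler_wpM2l.
have ls : 0 <= la * s by rewrite mulr_ge0.
have h : rho * N ^+ 2 <= c * N ^+ 2 * (6 * a ^+ 2 * la + 4 * a * e).
  apply: le_trans (ler_wpM2r N2 hrho) _.
  rewrite mulrAC -subr_ge0 -mulrBr mulr_ge0 //; lra.
have a2 : 1 <= a ^+ 2 by rewrite exprn_ege1.
have lcN : 0 <= la * (c * N ^+ 2) by rewrite mulr_ge0.
have := ler_wpM2l lcN a2; have := ler_wpM2l cN he; lra.
Qed.

(** As s <= s', the term (1 - la) s is absorbed by s', and division by la leaves
    s' <= 2 b' + 4 a e / la.  The inner product b' at the new iterate is compared
    with b at the old one, where the displacement is known to be small. *)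
Lemma ascent_value_small (R : realFieldType) (a q la e s s' b b' rho dy : R) :
  1 <= a -> 1 <= q -> 0 < la -> s <= s' -> la <= 1 ->
  la * (256 * a ^+ 2 * q ^+ 2) <= 1 -> rho * (128 * a * q ^+ 2) <= 1 ->
  96 * a * e * q ^+ 2 <= la ->
  b <= (32 * q ^+ 2)^-1 -> dy <= 3 / 2 * a * la + rho ->
  b' <= b + 3 / 2 * a * dy ->
  0 <= (1 - la) * s - s' + 2 * la * b' + 4 * a * e ->
  s' <= q^-1.
Proof.
move=> a1 q1 la0 ss la1 hla hrho he hb hdy hb' h.
have q2 : 0 < q ^+ 2 by rewrite exprn_gt0 //; lra.
have hbq : 32 * (b * q ^+ 2) <= 1.
  have q32 : 0 < 32 * q ^+ 2 by rewrite mulr_gt0.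
  by rewrite mulrCA -(ler_pdivlMr _ _ q32) div1r.
have hb2 : 2 * b' * q ^+ 2 <= 1 / 8.
  have h1 : b' * q ^+ 2 <= (b + 3 / 2 * a * (3 / 2 * a * la + rho)) * q ^+ 2.
    rewrite ler_wpM2r ?(ltW q2) //; apply: le_trans hb' _.
    by rewrite lerD2l ler_wpM2l //; lra.
  by lra.
have hls : la * s' <= 2 * la * b' + 4 * a * e.
  have : (1 - la) * s <= (1 - la) * s' by rewrite ler_wpM2l // subr_ge0.
  lra.
have : la * (s' * q ^+ 2) <= la * (1 / 6).
  have := ler_wpM2r (ltW q2) hls.
  by have := ler_wpM2l (ltW la0) hb2; lra.
rewrite ler_pM2l // => hq.
rewrite -[q^-1]mul1r ler_pdivlMr; last lra.
have [s0|s0] := leP s' 0; first by apply: le_trans (mulr_le0_ge0 s0 _) _; lra.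
by have : s' * q <= s' * q ^+ 2; [rewrite ler_pM2l // expr2; nra|lra].
Qed.

(** Combines the terms of [contraction_rec_bound]: P is the contraction factor, S the
    initial squared distance and er the accumulated error.  Each of the three terms
    gets a third of 1/q. *)
Lemma steady_value_small (R : realFieldType) (a q P S b er : R) :
  1 <= q -> 0 < a -> P <= (12 * a ^+ 2 * q)^-1 -> 0 <= S -> S <= 4 * a ^+ 2 ->
  b = 2 * (32 * q ^+ 2)^-1 -> er * (3 * q) <= 1 ->
  P * S + b + er <= q^-1.
Proof.
move=> q1 a0 hP S0 hS -> he; have q0 : 0 < q by lra.
have h1 : P * S <= (12 * a ^+ 2 * q)^-1 * (4 * a ^+ 2).
  apply: (@le_trans _ _ ((12 * a ^+ 2 * q)^-1 * S)); first by rewrite ler_wpM2r.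
  by rewrite ler_wpM2l // invr_ge0 mulr_ge0 ?(ltW q0) // mulr_ge0 ?sqr_ge0.
have e1 : (12 * a ^+ 2 * q)^-1 * (4 * a ^+ 2) = 1 / 3 * q^-1.
  by field; rewrite !gt_eqF.
have h2 : 2 * (32 * q ^+ 2)^-1 <= 1 / 16 * q^-1.
  have -> : 2 * (32 * q ^+ 2)^-1 = 1 / 16 * q^-1 * q^-1 by field; rewrite gt_eqF.
  by rewrite ler_piMr ?invf_le1 // mulr_ge0 // invr_ge0 ltW.
have h3 : er <= 1 / 3 * q^-1.
  have -> : 1 / 3 * q^-1 = 1 / (3 * q) by field; rewrite gt_eqF.
  by rewrite ler_pdivlMr // mulr_gt0.
have : 0 < q^-1 by rewrite invr_gt0.
lra.
Qed.

(** The truncated subtraction in [r1] costs at most one of the twelve summands. *)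
Lemma r1_ge c n : (0 < c)%N -> (11 * c * n.+1 ^ 2 <= r1 c n)%N.
Proof.
move=> c0; rewrite /r1 addn1 -!mulnA; have : (0 < c * n.+1 ^ 2)%N by rewrite muln_gt0 c0.
by move: (c * _)%N => X; lia.
Qed.

(** * The iteration without errors *)

Section UnperturbedIteration.
Context (R : realType) (H : completeNormedModType R) (ip : {dot H for idfun})
  (norm_ip : norm_of_dot ip) (A : H -> set H)
  (A_maxmon : maximal_monotone ip A) (u p : H) (Ap : zeros A p)
  (y : nat -> H) (c_ lambda gamma delta : nat -> R)
  (c_gt0 : forall n, 0 < c_ n)
  (lambda_itv : forall n, 0 < lambda n < 1)
  (gamma_itv : forall n, 0 <= gamma n < 1)
  (delta_itv : forall n, 0 < delta n < 1)
  (sum1 : forall n, lambda n + gamma n + delta n = 1)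
  (y_rec : forall n, y n.+1 =
    lambda n *: u + gamma n *: y n + delta n *: resolvent A (c_ n) (y n))
  (c : nat) (c_pos : (0 < c)%N)
  (cond4 : forall n, 1 / c%:R <= Num.min (c_ n) (delta n ^+ 2))
  (D : nat) (D_pos : (0 < D)%N)
  (uD : 2 * `|u - p| <= D%:R) (y0D : `|y 0%N - p| <= D%:R).

Local Notation J n := (resolvent A (c_ n)).
Local Notation T := (resolvent A (1 / c%:R)).
Local Notation a := (D%:R : R).

Let A_zero : zeros A !=set0. Proof. by exists p. Qed.

Let cR_gt0 : 0 < c%:R :> R. Proof. by rewrite ltr0n. Qed.

Let T_gt0 : 0 < 1 / c%:R :> R. Proof. by rewrite divr_gt0. Qed.

Lemma c_ge n : 1 / c%:R <= c_ n.
Proof. by apply: le_trans (cond4 n) _; rewrite ge_min lexx. Qed.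

Lemma delta_sq n : 1 <= c%:R * delta n ^+ 2.
Proof.
rewrite mulrC -ler_pdivrMr //; apply: le_trans (cond4 n) _.
by rewrite ge_min lexx orbT.
Qed.

Lemma iteration_bounded n : `|y n - p| <= D%:R.
Proof.
elim: n => // n IH; rewrite y_rec.
have -> : lambda n *: u + gamma n *: y n + delta n *: J n (y n) - p =
    lambda n *: (u - p) + gamma n *: (y n - p) + delta n *: (J n (y n) - p).
  rewrite -[X in _ - X]scale1r -(sum1 n); vec.
have /andP[/ltW l0 _] := lambda_itv n; have /andP[g0 _] := gamma_itv n.
have /andP[/ltW d0 _] := delta_itv n.
apply: le_trans (ler_normD _ _) _; rewrite normrZ ger0_norm //.
have := ler_normD (lambda n *: (u - p)) (gamma n *: (y n - p)).
rewrite !normrZ !ger0_norm //.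
have Jp : `|J n (y n) - p| <= a.
  rewrite -[p in X in X <= _](resolvent_zero norm_ip A_maxmon A_zero (c_gt0 n) Ap).
  exact: le_trans (resolvent_nonexpansive norm_ip A_maxmon A_zero _ _ (c_gt0 n)) IH.
have up : `|u - p| <= a by move: uD; have := normr_ge0 (u - p); lra.
have := ler_wpM2l l0 up; have := ler_wpM2l g0 IH; have := ler_wpM2l d0 Jp.
by have := congr1 (fun t => t * a) (sum1 n); rewrite /= !mulrDl mul1r; lra.
Qed.

Section ReferencePoint.
Context (x : H) (xD : `|x - p| <= D%:R).

Lemma dist_bounded n : `|y n - x| <= 2 * a.
Proof.
have -> : y n - x = (y n - p) - (x - p) by vec.
by have := ler_normB (y n - p) (x - p); have := iteration_bounded n; move: xD; lra.
Qed.

(** The basic recursion, with the displacement isolated on the left.  The convex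
    combination of y_n and J_n y_n gains delta_n (2 gamma_n + delta_n) times the
    squared displacement, of which delta_n^2 >= 1/c is kept. *)
Lemma iteration_inequality n (e : R) : `|J n x - x| <= e ->
  `|J n (y n) - y n| ^+ 2 <=
    c%:R * ((1 - lambda n) * `|y n - x| ^+ 2 - `|y n.+1 - x| ^+ 2
      + 2 * lambda n * ip (u - x) (y n.+1 - x) + 4 * a * e).
Proof.
move=> xe; have e0 := le_trans (normr_ge0 _) xe.
have a1 : 1 <= a by rewrite ler1n.
have firm := resolvent_firm_perturbed norm_ip A_maxmon A_zero x (y n) (c_gt0 n).
have refl : `|2 *: J n (y n) - y n - x| <= 2 * a.
  have -> : 2 *: J n (y n) - y n - x = (2 *: J n (y n) - y n - p) - (x - p) by vec.
  apply: le_trans (ler_normB _ _) _.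
  have := resolvent_reflect norm_ip A_maxmon A_zero (y n) (c_gt0 n) Ap.
  by have := iteration_bounded n; move: xD; lra.
have /andP[/ltW l0 l1] := lambda_itv n; have /andP[g0 _] := gamma_itv n.
have /andP[/ltW d0 d1] := delta_itv n; have dc := delta_sq n.
have sE := sum1 n.
have {}firm : `|J n (y n) - x| ^+ 2 <=
    `|y n - x| ^+ 2 - `|J n (y n) - y n| ^+ 2 + 4 * a * e.
  have h : `|J n x - x| * `|2 *: J n (y n) - y n - x| <= e * (2 * a) by apply: ler_pM.
  by move: firm; lra.
have yE : y n.+1 - x = lambda n *: (u - x) + gamma n *: (y n - x)
    + delta n *: (J n (y n) - x).
  by rewrite y_rec -[X in _ - X]scale1r -sE; vec.
have main : delta n ^+ 2 * `|J n (y n) - y n| ^+ 2 <=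
    (1 - lambda n) * `|y n - x| ^+ 2 - `|y n.+1 - x| ^+ 2
      + 2 * lambda n * ip (u - x) (y n.+1 - x) + 4 * a * e.
  have U0 := ip_ge0 norm_ip (u - x).
  have r0 := ip_ge0 norm_ip (J n (y n) - y n).
  have b0 := ip_ge0 norm_ip (y n - x).
  move: firm U0 r0 b0; rewrite yE.
  have -> : J n (y n) - y n = (J n (y n) - x) - (y n - x) by vec.
  move: (u - x) (y n - x) (J n (y n) - x) => U b v.
  rewrite !norm_ip !(ipE ip) ?(ipC ip b U) ?(ipC ip v U) ?(ipC ip v b).
  move: sE d0 d1 g0 l0 l1.
  move: (lambda n) (gamma n) (delta n) => l g d sE d0 d1 g0 l0 l1.
  move: (ip U U) (ip U b) (ip U v) (ip b b) (ip b v) (ip v v) => UU Ub Uv bb bv vv.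
  have lE : l = 1 - g - d by lra.
  move=> firm U0 r0 b0.
  have h1 : 0 <= d * (g + d) * (bb - (vv - bv - (bv - bb)) + 4 * a * e - vv).
    by apply: mulr_ge0; [apply: mulr_ge0; lra|lra].
  have h2 : 0 <= l ^+ 2 * UU by rewrite mulr_ge0 ?sqr_ge0.
  have {}r0 : 0 <= vv - bv - (bv - bb) by lra.
  have h3 : 0 <= 2 * d * g * (vv - bv - (bv - bb)).
    by apply: (mulr_ge0 _ r0); apply: mulr_ge0 => //; lra.
  have h4 : 0 <= (1 - d * (g + d)) * (4 * a * e).
    apply: mulr_ge0; last by apply: mulr_ge0 => //; lra.
    by rewrite subr_ge0; apply: mulr_ile1; lra.
  have h5 : 0 <= (1 - l) * l * bb by apply: mulr_ge0 => //; apply: mulr_ge0; lra.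
  move: h1 h2 h3 h4 h5; rewrite lE; lra.
have r0 : 0 <= `|J n (y n) - y n| ^+ 2 by rewrite sqr_ge0.
have := ler_wpM2r r0 dc; have := ler_wpM2l (ltW cR_gt0) main; lra.
Qed.
End ReferencePoint.

Lemma resolvent_le_J i x : `|T x - x| <= `|J i x - x|.
Proof.
have [h _] := resolvent_parameter norm_ip A_maxmon A_zero x T_gt0 (c_ge i).
by rewrite distrC (distrC _ x).
Qed.

Context (C : nat -> nat) (C_mon : monotone_fun C)
  (C_bound : forall n, c_ n <= (C n)%:R).

(** The purpose of [zeta]: a single resolvent controls all J_i with i <= n, because
    the displacement divided by the parameter decreases in the parameter, and the
    parameters lie between 1/c and C n. *)
Lemma zeta_resolvent j n i x : (i <= n)%N ->
  `|T x - x| <= (zeta c C j n).+1%:R^-1 -> `|J i x - x| <= j.+1%:R^-1.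
Proof.
move=> lein; have Cn0 : (0 < C n)%N.
  by rewrite -(ltr_nat R) (lt_le_trans (c_gt0 n)).
have Cin : c_ i <= (C n)%:R.
  by apply: le_trans (C_bound i) _; rewrite ler_nat monotone_leq.
have [_ h] := resolvent_parameter norm_ip A_maxmon A_zero x T_gt0 (c_ge i).
have -> : (zeta c C j n).+1 = (c * j.+1 * C n)%N.
  by rewrite /zeta addn1 subn1 prednK // !muln_gt0 c_pos.
rewrite distrC !(distrC _ x) !natrM => Tx.
have C0 : 0 < (C n)%:R :> R by rewrite ltr0n.
have j0 : 0 < j.+1%:R :> R by rewrite ltr0n.
have : 1 / c%:R * `|x - J i x| <= (C n)%:R * (c%:R * j.+1%:R * (C n)%:R)^-1.
  by apply: le_trans h _; apply: ler_pM => //; exact: ltW.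
have -> : (C n)%:R * (c%:R * j.+1%:R * (C n)%:R)^-1 = 1 / c%:R * j.+1%:R^-1 :> R.
  by field; rewrite !gt_eqF.
by rewrite ler_pM2l.
Qed.

Context (h l L : nat -> nat)
  (h_pos : forall n, (0 < h n)%N) (h_mon : monotone_fun h)
  (l_mon : monotone_fun l) (L_mon : monotone_fun L)
  (cond1 : forall n, 1 / (h n)%:R <= lambda n)
  (cond2 : forall k n, (l k <= n)%N -> lambda n <= 1 / k.+1%:R)
  (cond3 : forall k, k%:R <= \sum_(1 <= i < (L k).+1) lambda i).

Lemma cond2_mul K n : (0 < K)%N -> (l (K - 1) <= n)%N -> lambda n * K%:R <= 1.
Proof.
by move=> K0 /cond2; rewrite subn1 prednK // ler_pdivlMr ?ltr0n.
Qed.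

Lemma r3_ge_steady k n : (l (96 * c * D ^ 2 * (n + 1) ^ 2 - 1) <= r3 c D l k n)%N.
Proof. by apply: monotone_leq => //; rewrite leq_maxl. Qed.

Lemma r3_ge_step k n : (l (256 * D ^ 2 * (k + 1) ^ 2 - 1) <= r3 c D l k n)%N.
Proof. by apply: monotone_leq => //; rewrite !leq_max leqnn orbT. Qed.

Lemma r3_ge_ascent k n : (l (16 * c * r2 D k n ^ 2 * D ^ 2) <= r3 c D l k n)%N.
Proof. by apply: monotone_leq => //; rewrite !leq_max leqnn !orbT. Qed.

Lemma r3_mono k : {homo r3 c D l k : m n / (m <= n)%N}.
Proof.
move=> m n mn; rewrite /r3; apply: monotone_leq => //.
have r2mn : (r2 D k m <= r2 D k n)%N.
  by rewrite /r2 geq_max !leq_max leqnn orbT andbT leq_mul2l leq_add2r mn.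
rewrite !geq_max !leq_max leqnn; apply/and3P; split; rewrite ?orbT //.
- by rewrite leq_sub2r // leq_mul2l leq_sqr leq_add2r mn orbT.
- by apply/orP; right; apply/orP; right; rewrite leq_mul2r leq_mul2l leq_sqr r2mn !orbT.
Qed.

Lemma r1_mono : {homo r1 c : m n / (m <= n)%N}.
Proof. by move=> m n mn; rewrite leq_sub2r // leq_mul2l leq_sqr leq_add2r mn orbT. Qed.

(** ** Metastability of the iteration *)

Section Metastability.
Context (k : nat) (f : nat -> nat) (f_mon : monotone_fun f).

Local Notation ft := (f_tilde R D L k f).
Local Notation ft2 := (f_tilde2 R D L k f).
Local Notation sb := (sigma_bar R D L k).
Local Notation Ph := (Phi R c D l L k f).
Local Notation rr3 := (r3 c D l k).
Local Notation q := (k.+1%:R : R).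

Lemma sigma_bar_mono : monotone_fun sb.
Proof. by move=> n; rewrite /sigma_bar leq_add2r monotone_leq // leq_add2r. Qed.

Lemma f_tilde_mono : monotone_fun ft.
Proof. exact: monotone_comp sigma_bar_mono. Qed.

Lemma f_tilde2_mono : monotone_fun ft2.
Proof. by move=> n; rewrite leq_add2r f_tilde_mono. Qed.

Lemma phi2_arg_mono : {homo (fun n => phi2 D (r1 c n) (rr3 n) ft2) : m n / (m <= n)%N}.
Proof.
move=> m n mn; apply: phi2_mono; [exact: f_tilde2_mono|exact: r1_mono|exact: r3_mono].
Qed.

Lemma Phi_mono : {homo Ph : m n / (m <= n)%N}.
Proof. by move=> m n mn; apply: (monotone_leq f_tilde2_mono); exact: phi2_arg_mono. Qed.

Section AtReferencePoint.
Context (N : nat) (x : H) (xD : `|x - p| <= D%:R)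
  (Tx : `|T x - x| <= (Xi R c D C h l L k f N).+1%:R^-1)
  (x_proj : forall z, `|z - p| <= D%:R -> `|T z - z| <= N.+1%:R^-1 ->
     ip (u - x) (z - x) <= (32 * q ^+ 2)^-1).

Local Notation s i := (`|y i - x| ^+ 2).
Local Notation rho i := (`|J i (y i) - y i|).

Let a1 : 1 <= a. Proof. by rewrite ler1n. Qed.
Let c1 : 1 <= c%:R :> R. Proof. by rewrite ler1n. Qed.
Let q1 : 1 <= q. Proof. by rewrite ler1n. Qed.
Let N1 : 1 <= N.+1%:R :> R. Proof. by rewrite ler1n. Qed.
Let la0 i : 0 < lambda i. Proof. by have /andP[] := lambda_itv i. Qed.
Let la1 i : lambda i < 1. Proof. by have /andP[] := lambda_itv i. Qed.

Lemma dist_sq_bounded i : s i <= 4 * a ^+ 2.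
Proof.
have -> : 4 * a ^+ 2 = (2 * a) ^+ 2 by ring.
by rewrite lerXn2r ?nnegrE ?dist_bounded //; move: a1; lra.
Qed.

Lemma anchor_dist : `|u - x| <= 3 / 2 * a.
Proof.
have -> : u - x = (u - p) - (x - p) by vec.
by have := ler_normB (u - p) (x - p); move: uD xD; lra.
Qed.

Lemma anchor_ip_le i : ip (u - x) (y i - x) <= 3 * a ^+ 2.
Proof.
apply: le_trans (ip_le_norm norm_ip _ _) _.
apply: (@le_trans _ _ ((3 / 2 * a) * (2 * a))); last lra.
by apply: ler_pM; rewrite ?anchor_dist ?dist_bounded.
Qed.

Lemma small_displacement_proj i :
  rho i * N.+1%:R <= 1 -> ip (u - x) (y i - x) <= (32 * q ^+ 2)^-1.
Proof.
move=> hi; apply: x_proj; first exact: iteration_bounded.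
apply: le_trans (resolvent_le_J i _) _.
by rewrite -[X in _ <= X]mul1r ler_pdivlMr ?ltr0n.
Qed.

Lemma Xi1_resolvent i : (i <= Ph N)%N ->
  `|J i x - x| <=
    (2 * (6 * D + 1) * maxn (r1 c N) (r4 R c D l L k f N))%:R^-1.
Proof.
move=> iP; set M := (2 * _ * _)%N.
have M0 : (0 < M)%N.
  by rewrite !muln_gt0 addn1 leq_max /r4 !muln_gt0 !addn1 orbT.
have -> : M%:R^-1 = (M - 1).+1%:R^-1 :> R by rewrite subn1 prednK.
apply: (zeta_resolvent iP); apply: le_trans Tx _.
by rewrite lef_pV2 ?posrE ?ltr0n // ler_nat ltnS leq_maxl.
Qed.

Lemma Xi2_resolvent i : (i <= f (Ph N))%N ->
  `|J i x - x| <= (16 * h (f (Ph N)) * (k + 1) ^ 2 * (6 * D + 1))%:R^-1.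
Proof.
move=> iP; set M := (16 * _ * _ * _)%N.
have M0 : (0 < M)%N by rewrite !muln_gt0 h_pos addn1 /= addn1.
apply: (@le_trans _ _ (maxn M (4 * c * r2 D k (Ph N) ^ 2 * (6 * D + 1))).+1%:R^-1).
  apply: (zeta_resolvent iP); apply: le_trans Tx _.
  by rewrite lef_pV2 ?posrE ?ltr0n // ler_nat ltnS leq_maxr.
by rewrite lef_pV2 ?posrE ?ltr0n // ler_nat ltnW // ltnS leq_maxl.
Qed.

Lemma iteration_step_bound n : `|y n.+1 - y n| <= 3 / 2 * a * lambda n + rho n.
Proof.
have -> : y n.+1 - y n = lambda n *: (u - y n) + delta n *: (J n (y n) - y n).
  by rewrite y_rec -[X in _ - X]scale1r -(sum1 n); vec.
apply: le_trans (ler_normD _ _) _; have /andP[/ltW d0 /ltW d1] := delta_itv n.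
rewrite !normrZ (ger0_norm (ltW (la0 n))) (ger0_norm d0); apply: lerD.
  rewrite mulrC ler_wpM2r ?(ltW (la0 n)) //.
  have -> : u - y n = (u - p) - (y n - p) by vec.
  apply: le_trans (ler_normB _ _) _.
  by move: uD (iteration_bounded n); lra.
by rewrite ler_piMl.
Qed.

(** Between m and ft2 m the squared distance s is almost constant, so all
    displacements there are small and s obeys the contractive recursion with a
    small inner product.  The index sb m is chosen so that the contraction has
    become effective between m and sb m; as ft m = f (sb m), the recursion is
    available up to f (sb m). *)
Lemma steady_case : (forall i, (rr3 N <= i < Ph N)%N -> s i.+1 <= s i) ->
  exists2 n, (n <= sb (phi2 D (r1 c N) (rr3 N) ft2))%N &
    forall i, (n <= i <= f n)%N -> s i <= q^-1.
Proof.
move=> dec; pose d : R := (12 * c * (N + 1) ^ 2)%:R^-1.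
have r1E : (r1 c N + 1 = 12 * c * (N + 1) ^ 2)%N.
  by rewrite /r1 subnK // !muln_gt0 c_pos addn1.
have [||| m [rm mphi hm]] := @metastable_step R (fun i => s i) ft2 (rr3 N)
    (4 * D ^ 2 * (r1 c N + 1)) d f_tilde2_mono.
- by move=> i; rewrite sqr_ge0.
- by rewrite !muln_gt0 D_pos addn1.
- rewrite r1E -mulr_natl (natrM _ (4 * D ^ 2)%N) /d mulfK; last first.
    by rewrite pnatr_eq0 -lt0n !muln_gt0 c_pos addn1.
  by rewrite natrM natrX; exact: dist_sq_bounded.
exists (sb m); first exact: monotone_leq sigma_bar_mono mphi.
move=> i /andP[mi ilt]; have {}ilt : (i <= ft m)%N by [].
have gP : (ft2 m <= Ph N)%N by exact: monotone_leq f_tilde2_mono mphi.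
have msb : (m < sb m)%N.
  rewrite /sigma_bar addn1 ltnS; apply: leq_trans (rate_ge lambda_itv cond3 _).
  exact: leq_addr.
have mi' : (m < i)%N by exact: leq_trans mi.
have mg : (m <= ft2 m)%N := leq_trans (leq_trans (ltnW mi') ilt) (leq_addr 2 _).
have {}hm := hm mg.
have decr j1 j2 : (m <= j1)%N -> (j1 <= j2)%N -> (j2 <= ft2 m)%N -> s j2 <= s j1.
  move=> mj1 /subnK <-; elim: (j2 - j1)%N => //= n IH jg.
  apply: le_trans (IH (ltnW jg)); rewrite addSn; apply: dec.
  apply/andP; split; last exact: leq_trans jg gP.
  exact: leq_trans rm (leq_trans mj1 (leq_addl _ _)).
pose M := maxn (r1 c N) (r4 R c D l L k f N).
pose e : R := (2 * (6 * D + 1) * M)%:R^-1.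
have M0 : (0 < M)%N by rewrite leq_max /r4 !muln_gt0 !addn1 orbT.
have eM : e * (2 * (6 * a + 1) * M%:R) = 1.
  rewrite /e !natrM natrD natrM mulVf // gt_eqF //.
  by rewrite !mulr_gt0 ?ltr0n // ltr_wpDl ?mulr_ge0.
have e0 : 0 <= e by rewrite invr_ge0 ler0n.
have xe j (jg : (j <= ft2 m)%N) : `|J j x - x| <= e.
  exact: Xi1_resolvent (leq_trans jg gP).
clearbody e.
have main j (jg : (j <= ft2 m)%N) := iteration_inequality xD (xe j jg).
have small j : (m <= j)%N -> (j < ft2 m)%N -> rho j * N.+1%:R <= 1.
  move=> mj jg; rewrite -(ler_pXn2r (n := 2)) ?nnegrE ?mulr_ge0 // expr1n exprMn.
  have hla : lambda j * (96 * c%:R * a ^+ 2 * N.+1%:R ^+ 2) <= 1.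
    have K0 : (0 < 96 * c * D ^ 2 * (N + 1) ^ 2)%N.
      by rewrite !muln_gt0 c_pos D_pos addn1.
    have := cond2_mul K0 (leq_trans (r3_ge_steady k N) (leq_trans rm mj)).
    by rewrite addn1 !natrM -!mulrA; apply.
  have hr : 11 * c%:R * N.+1%:R ^+ 2 <= M%:R :> R.
    by rewrite -natrX -!natrM ler_nat leq_max r1_ge.
  have hs : (s j - s j.+1) * (12 * c%:R * N.+1%:R ^+ 2) <= 1.
    have -> : 12 * c%:R * N.+1%:R ^+ 2 = d^-1 :> R.
      by rewrite /d invrK addn1 -natrX -!natrM.
    rewrite ler_pdivrMr ?mul1r; last by rewrite invr_gt0 ltr0n !muln_gt0 c_pos addn1.
    apply: le_trans hm; apply: lerB; apply: decr => //.
      exact: ltnW.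
    exact: leqW.
  apply: (small_displacement_steady c1 a1 N1 (ltW (la0 j)) e0 _ hla hr _ hs
    (anchor_ip_le j.+1) (main j (ltnW jg))); first by rewrite sqr_ge0.
  by rewrite eM.
pose b : R := 2 * (32 * q ^+ 2)^-1.
have rec j : (m <= j < i)%N ->
    s j.+1 <= (1 - lambda j) * s j + lambda j * b + 4 * a * e.
  move=> /andP[mj ji].
  (* The inner product is taken at y_(j+1), whose displacement is controlled by
     the step from j+1 to j+2: hence the + 2 in ft2. *)
  have jg : (j.+1 < ft2 m)%N.
    by rewrite /f_tilde2 addn2 !ltnS (leq_trans (ltnW ji)).
  have := le_trans (sqr_ge0 _) (main j (ltnW (ltnW jg))); rewrite pmulr_rge0 //.
  have := ler_wpM2l (ltW (la0 j)) (small_displacement_proj (small j.+1 (leqW mj) jg)).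
  by rewrite /b; move: ((32 * q ^+ 2)^-1) => v; lra.
have la01 j : 0 <= lambda j <= 1 by rewrite !ltW.
have b0 : 0 <= b by rewrite mulr_ge0 // invr_ge0 mulr_ge0 ?sqr_ge0.
have ae0 : 0 <= 4 * a * e by rewrite mulr_ge0 // mulr_ge0.
have := contraction_rec_bound la01 (fun=> ae0) b0 (ltnW mi') rec.
move=> /le_trans; apply; rewrite sumr_const_nat.
have X0 : (0 < 12 * D ^ 2 * (k + 1))%N by rewrite !muln_gt0 D_pos addn1.
apply: (@steady_value_small R a q) => //.
- by rewrite ltr0n.
- apply: le_trans (prod_tail_le lambda_itv cond3 X0 (leqnSn m) _) _.
    by move: mi; rewrite /sigma_bar addn1.
  by rewrite addn1 !natrM -!mulrA.
- exact: dist_sq_bounded.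
have hM : 3 * q * (i - m)%:R <= M%:R.
  rewrite -!natrM ler_nat leq_max; apply/orP; right.
  rewrite /r4 addn1 leq_mul2l /=; apply: (@leq_trans (ft m)).
    exact: leq_trans (leq_subr _ _) ilt.
  by rewrite addn1; apply: leqW; exact: monotone_leq f_tilde_mono mphi.
rewrite -[_ *+ _]mulr_natr; have := ler_wpM2l e0 hM.
have a0 : 0 <= a by rewrite ler0n.
move=> /(ler_wpM2l a0); have : 0 <= e * M%:R by rewrite mulr_ge0.
by move: eM; lra.
Qed.

(** At an index of increase beyond [r3] the step size is small enough to make first
    the displacement and then the next squared distance small. *)
Lemma ascent_step i : (rr3 N <= i < f (Ph N))%N -> s i < s i.+1 -> s i.+1 <= q^-1.
Proof.
move=> /andP[ri iP] /ltW ss; pose F := h (f (Ph N)).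
pose e : R := (16 * F * (k + 1) ^ 2 * (6 * D + 1))%:R^-1.
have xe : `|J i x - x| <= e by apply: Xi2_resolvent; exact: ltnW.
have e0 := le_trans (normr_ge0 _) xe.
have F0 : 0 < F%:R :> R by rewrite ltr0n h_pos.
have laF : 1 <= lambda i * F%:R.
  rewrite -ler_pdivrMr //; apply: le_trans (cond1 i).
  by rewrite ler_pM2l // lef_pV2 ?posrE ?ltr0n ?h_pos // ler_nat monotone_leq // ltnW.
have he : 96 * a * e * q ^+ 2 <= lambda i.
  apply: (error_le_step a1 q1 e0 laF (ltW (la0 i)) (ltW F0)).
  have <- : (16 * F * (k + 1) ^ 2 * (6 * D + 1))%:R =
      16 * F%:R * q ^+ 2 * (6 * a + 1) :> R.
    by rewrite [(k + 1)%N]addn1 !natrM natrD natrM expr2.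
  by rewrite /e mulVf // pnatr_eq0 -lt0n !muln_gt0 h_pos addn1 /= addn1.
have main := iteration_inequality xD xe.
have he1 : 96 * a * e <= lambda i.
  apply: le_trans he; rewrite ler_peMr ?exprn_ege1 //.
  by rewrite !mulr_ge0.
have s0 : 0 <= s i by rewrite sqr_ge0.
have hr2 : rho i * (r2 D k N)%:R <= 1.
  rewrite -(ler_pXn2r (n := 2)) ?nnegrE ?mulr_ge0 // expr1n exprMn.
  have l0 := ltW (la0 i).
  apply: (small_displacement_ascent c1 a1 l0 e0 s0 ss _ he1 (anchor_ip_le i.+1) main).
  have /cond2 : (l (16 * c * r2 D k N ^ 2 * D ^ 2) <= i)%N.
    by apply: leq_trans ri; exact: r3_ge_ascent.
  rewrite ler_pdivlMr ?ltr0n // => hl; apply: le_trans hl.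
  by rewrite ler_wpM2l // -!natrX -!natrM ler_nat leqnSn.
have hla : lambda i * (256 * a ^+ 2 * q ^+ 2) <= 1.
  have K0 : (0 < 256 * D ^ 2 * (k + 1) ^ 2)%N by rewrite !muln_gt0 D_pos addn1.
  have := cond2_mul K0 (leq_trans (r3_ge_step k N) ri).
  by rewrite addn1 !natrM -!mulrA; apply.
apply: (@ascent_value_small R a q (lambda i) e (s i) (s i.+1)
  (ip (u - x) (y i - x)) (ip (u - x) (y i.+1 - x)) (rho i) `|y i.+1 - y i|) => //.
- exact: ltW.
- apply: le_trans hr2; rewrite ler_wpM2l // -natrX -!natrM ler_nat.
  by rewrite leq_max !addn1 leqnn orbT.
- apply: small_displacement_proj; apply: le_trans hr2; rewrite ler_wpM2l // ler_nat.
  by rewrite leq_max mul2n -addnn addn1 leq_addr.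
- exact: iteration_step_bound.
- have -> : y i.+1 - x = (y i - x) + (y i.+1 - y i) by vec.
  rewrite ipDr lerD2l; apply: le_trans (ip_le_norm norm_ip _ _) _.
  by rewrite ler_wpM2r // anchor_dist.
- have := le_trans (sqr_ge0 _) main; rewrite pmulr_rge0 //.
Qed.

(** After one increase before [Ph N], the squared distance is small at every later
    index up to [f (Ph N)]: it is small after each increase and it can only drop
    otherwise. *)
Lemma ascent_case m : (rr3 N <= m < Ph N)%N -> s m < s m.+1 ->
  forall i, (Ph N <= i <= f (Ph N))%N -> s i <= q^-1.
Proof.
move=> /andP[rm mP] sm i /andP[Pi iF].
have := leq_trans mP Pi; elim: i iF {Pi} => // i IH iF mi.
have ri : (rr3 N <= i < f (Ph N))%N by rewrite iF (leq_trans rm).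
have [ss|ss] := ltP (s i) (s i.+1); first exact: ascent_step ss.
move: mi; rewrite ltnS leq_eqVlt => /orP[/eqP mi|mi].
  by move: ss; rewrite -mi leNgt sm.
by apply: le_trans ss _; apply: IH => //; exact: ltnW.
Qed.

End AtReferencePoint.

(** The level N is only known to lie below beta, whereas the functional evaluates
    its ingredients at beta itself: this is where their monotonicity is needed. *)
Lemma mu_metastable : exists n x, (n <= mu R c D C h l L k f)%N /\
  forall i, (n <= i <= f n)%N -> `|y i - x| ^+ 2 <= q^-1.
Proof.
have T_ne b b' : `|T b - T b'| <= `|b - b'|.
  exact: (resolvent_nonexpansive norm_ip A_maxmon A_zero _ _ T_gt0).
have Tp := resolvent_zero norm_ip A_maxmon A_zero T_gt0 Ap.
have [N [x [Nb xD Tx xproj]]] := approx_projection norm_ip T_ne Tp D_pos uD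
  (32 * (k + 1) ^ 2 - 1) (Xi R c D C h l L k f).
have {}xproj z : `|z - p| <= D%:R -> `|T z - z| <= N.+1%:R^-1 ->
    ip (u - x) (z - x) <= (32 * q ^+ 2)^-1.
  have -> : 32 * q ^+ 2 = (32 * (k + 1) ^ 2 - 1).+1%:R :> R.
    by rewrite subn1 prednK ?muln_gt0 ?addn1 // natrM natrX.
  exact: xproj.
have [dec|/existsNP[m /not_implyP[mP]]] :=
  pselect (forall i, (rr3 N <= i < Ph N)%N -> `|y i.+1 - x| ^+ 2 <= `|y i - x| ^+ 2).
  have [n nle hn] := steady_case xD Tx xproj dec.
  exists n, x; split => //; apply: leq_trans nle _.
  by rewrite leq_max (monotone_leq sigma_bar_mono) // phi2_arg_mono.
move=> /negP; rewrite -ltNge => lt.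
exists (Ph N), x; split; last by move=> i hi; exact: (ascent_case xD Tx xproj mP lt hi).
by rewrite leq_max Phi_mono // orbT.
Qed.

End Metastability.

(** Two consecutive iterates are close to the same point x, and
    delta_n (J_n y_n - y_n) = (y_(n+1) - y_n) - lambda_n (u - y_n). *)
Lemma mu_tilde_regular k f : monotone_fun f ->
  exists2 n, (n <= mu_tilde R c D C h l L k f)%N &
    forall i, (n <= i <= f n)%N -> `|J i (y i) - y i| <= k.+1%:R^-1.
Proof.
move=> f_mon; set l0 := l (4 * c * D * (k + 1) - 1).
have fc_mon : monotone_fun (fun m => f_check c D l k f m + 1)%N.
  move=> m; rewrite leq_add2r /f_check; apply: monotone_leq => //.
  by rewrite geq_max !leq_max leqnSn leqnn orbT.
have [n0 [x [n0le hn0]]] := mu_metastable (16 * c ^ 2 * (k + 1) ^ 2 - 1) fc_mon.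
exists (maxn n0 l0); first by rewrite geq_max leq_maxr (leq_trans n0le) ?leq_maxl.
move=> i /andP[]; rewrite geq_max => /andP[n0i l0i] ifn.
have c1 : 1 <= c%:R :> R by rewrite ler1n.
have a1 : 1 <= a by rewrite ler1n.
have q1 : 1 <= k.+1%:R :> R by rewrite ler1n.
have close j : (n0 <= j <= i.+1)%N -> `|y j - x| * (4 * c%:R * k.+1%:R) <= 1.
  move=> /andP[n0j ji]; rewrite -(ler_pXn2r (n := 2)) ?nnegrE ?mulr_ge0 //.
  rewrite expr1n exprMn -ler_pdivlMr ?exprn_gt0 ?mulr_gt0 //.
  have -> : (4 * c%:R * k.+1%:R) ^+ 2 = (16 * c ^ 2 * (k + 1) ^ 2 - 1).+1%:R :> R.
    rewrite subn1 prednK ?muln_gt0 ?expn_gt0 ?c_pos ?addn1 // !natrM; ring.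
  rewrite mul1r; apply: hn0; rewrite n0j /=.
  by apply: leq_trans ji _; rewrite addn1 ltnS.
have ci := close i; have ci1 := close i.+1.
have /andP[d0 d1] := delta_itv i; have /andP[la0 la1] := lambda_itv i.
have hla : lambda i * (4 * c%:R * a * k.+1%:R) <= 1.
  have K0 : (0 < 4 * c * D * (k + 1))%N by rewrite !muln_gt0 c_pos D_pos addn1.
  by have := cond2_mul K0 l0i; rewrite addn1 !natrM.
have dc : 1 <= c%:R * delta i.
  apply: le_trans (delta_sq i) _; rewrite ler_pM2l // expr2 ler_piMr ?ltW //.
have dJ : delta i * `|J i (y i) - y i| <=
    lambda i * (2 * a) + `|y i.+1 - x| + `|y i - x|.
  rewrite -[delta i in X in X <= _](gtr0_norm d0) -normrZ.
  have -> : delta i *: (J i (y i) - y i) = (y i.+1 - x) - (y i - x)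
      - lambda i *: ((u - p) - (y i - p)).
    have lE : lambda i = 1 - gamma i - delta i by rewrite -(sum1 i); ring.
    by rewrite y_rec lE; vec.
  apply: le_trans (ler_normB _ _) _; rewrite normrZ (gtr0_norm la0).
  have h1 := ler_normB (y i.+1 - x) (y i - x).
  have h2 : `|(u - p) - (y i - p)| <= 2 * a.
    apply: le_trans (ler_normB _ _) _.
    by have := normr_ge0 (u - p); move: uD (iteration_bounded i); lra.
  by have := ler_wpM2l (ltW la0) h2; move: h1; lra.
have q0 : 0 < k.+1%:R :> R by rewrite ltr0n.
rewrite -[X in _ <= X]mul1r ler_pdivlMr //.
have r0 := normr_ge0 (J i (y i) - y i).
have {}dJ : c%:R * delta i * (`|J i (y i) - y i| * k.+1%:R) <= 1.
  have cq0 : 0 <= c%:R * k.+1%:R :> R by rewrite mulr_ge0.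
  have := ler_wpM2r cq0 dJ.
  have := ci1 (_ : (n0 <= i.+1 <= i.+1)%N); have := ci (_ : (n0 <= i <= i.+1)%N).
  by rewrite n0i leqnSn leqnn leqW // => /(_ isT) + /(_ isT); lra.
by apply: le_trans dJ; rewrite ler_peMl // mulr_ge0.
Qed.
End UnperturbedIteration.

(** * Propagation of the errors *)

Section ErrorPropagation.
Context (R : realType) (la er w : nat -> R) (L E : nat -> nat) (d0 d1 d2 : nat)
  (la01 : forall n, 0 < la n < 1) (er0 : forall n, 0 <= er n)
  (w_rec : forall n, w n.+1 <= (1 - la n) * w n + er n)
  (w_init : w 0%N = 0) (w0 : forall n, 0 <= w n)
  (L_div : forall k, k%:R <= \sum_(1 <= i < (L k).+1) la i)
  (er_small :
    (forall k n, \sum_((E k).+1 <= i < (E k + n).+1) er i <= 1 / k.+1%:R) \/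
    (forall k n, (E k <= n)%N -> er n / la n <= 1 / k.+1%:R))
  (d2_pos : (0 < d2)%N)
  (d1_bound : \sum_(0 <= i < (E 0%N).+1) er i + 1 <= d1%:R)
  (d2_bound : forall n, (n <= E 0%N)%N -> w n <= d2%:R).

(** For summable errors w_n is at most the sum of the errors, the tail after E 0
    being at most 1.  For errors relative to the step size, w_(n+1) is from E 0 on
    at most a convex combination of w_n and 1, and d2 is at least 1. *)
Lemma error_bounded n : w n <= (maxn (2 * d0 + d1) d2)%:R.
Proof.
have la_ge0 i : 0 <= la i by have /andP[/ltW] := la01 i.
have la_le1 i : la i <= 1 by have /andP[_ /ltW] := la01 i.
case: er_small => [hE|hE].
  have wS m : w m <= \sum_(0 <= i < m) er i.
    elim: m => [|m IH]; first by rewrite w_init big_geq.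
    rewrite big_nat_recr //=; apply: le_trans (w_rec m) _; rewrite lerD2r.
    apply: le_trans IH; rewrite ler_piMl // lerBlDr lerDl.
    exact: la_ge0.
  apply: (le_trans (wS n)); apply: (@le_trans _ _ d1%:R); last first.
    by rewrite ler_nat (leq_trans _ (leq_maxl _ _)) ?leq_addl.
  apply: le_trans d1_bound; have [nE|En] := leqP n (E 0%N).+1.
    rewrite [X in _ <= X + 1](big_cat_nat (n := n)) //= -addrA lerDl.
    by rewrite addr_ge0 // sumr_ge0.
  rewrite (big_cat_nat (n := (E 0%N).+1)) ?(ltnW En) //= lerD2l.
  have := hE 0%N (n - (E 0%N).+1)%N.
  by rewrite divr1 -addSn subnKC // ltnW.
apply: (@le_trans _ _ d2%:R); last by rewrite ler_nat leq_max leqnn orbT.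
elim: n => [|n IH]; first exact: d2_bound.
have [nE|En] := leqP n.+1 (E 0%N); first exact: d2_bound.
have := hE 0%N n En; rewrite divr1 ler_pdivrMr ?mul1r; last first.
  by have /andP[] := la01 n.
move=> h; apply: le_trans (w_rec n) _.
have h1 : 0 <= 1 - la n by rewrite subr_ge0.
have := ler_wpM2l h1 IH; have d21 : 1 <= d2%:R :> R by rewrite ler1n.
by have := ler_wpM2l (la_ge0 n) d21; move: h; lra.
Qed.

(** The recursion is started just after E (3 j + 2), where either kind of error
    contributes at most 1/(3 (j + 1)) from then on, and run until the contraction
    brings the initial value below 1/(3 (j + 1)). *)
Lemma error_rate j n : (Theta R L E d0 d1 d2 j <= n)%N -> w n <= j.+1%:R^-1.
Proof.
set d := maxn (2 * d0 + d1) d2; rewrite /Theta -/d addn1 => Ln.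
have d_pos : (0 < d)%N by rewrite leq_max d2_pos orbT.
have X0 : (0 < 3 * d * (j + 1))%N by rewrite !muln_gt0 d_pos addn1.
set m := E (3 * j + 2).
have mn : (m.+1 <= n)%N.
  apply: leq_ltn_trans Ln; apply: leq_trans (rate_ge la01 L_div _).
  exact: leq_addr.
have la01' i : 0 <= la i <= 1 by have /andP[/ltW -> /ltW ->] := la01 i.
have hP := prod_tail_le la01 L_div X0 (leqnn m.+1) Ln.
have j0 : 0 < j.+1%:R :> R by rewrite ltr0n.
have dR0 : 0 < d%:R :> R by rewrite ltr0n.
have hPw : \prod_(m.+1 <= i < n) (1 - la i) * w m.+1 <= 1 / 3 * j.+1%:R^-1.
  apply: (@le_trans _ _ ((3 * d * (j + 1))%:R^-1 * d%:R)).
    by apply: ler_pM => //; [exact: prod_contraction_ge0|exact: error_bounded].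
  by rewrite addn1 !natrM le_eqVlt; apply/orP; left; apply/eqP; field; rewrite !gt_eqF.
have jE : 1 / (3 * j + 2).+1%:R = 1 / 3 * j.+1%:R^-1 :> R.
  have -> : (3 * j + 2).+1 = (3 * j.+1)%N by lia.
  by rewrite natrM; field; rewrite gt_eqF.
have jV0 : 0 < j.+1%:R^-1 :> R by rewrite invr_gt0.
case: er_small => hE.
  have := contraction_rec_bound (b := 0) la01' er0 (lexx _) mn.
  move=> /(_ w); rewrite addr0 => /(_ _)/le_trans; apply.
    by move=> i _; rewrite mulr0 addr0.
  have := hE (3 * j + 2)%N (n - m.+1)%N; rewrite -/m -addSn subnKC // jE.
  by move: jV0 hPw; move: (j.+1%:R^-1) => v; lra.
pose b : R := 1 / 3 * j.+1%:R^-1.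
have b0 : 0 <= b by rewrite /b mulr_ge0 // ltW.
have := contraction_rec_bound (er := fun=> 0) la01' (fun=> lexx _) b0 mn.
move=> /(_ w) /(_ _)/le_trans; apply; last first.
  by rewrite [X in _ + X]big1 // /b; move: jV0 hPw; move: (j.+1%:R^-1) => v; lra.
move=> i /andP[mi _]; rewrite addr0; apply: le_trans (w_rec i) _; rewrite lerD2l.
rewrite mulrC -ler_pdivrMr ?(andP (la01 i)).1 // /b -jE; apply: hE.
exact: ltnW.
Qed.
End ErrorPropagation.

(** * Asymptotic regularity *)

Theorem corollary3p12
  (R : realType) (H : completeNormedModType R) (ip : {dot H for idfun})
  (norm_ip : norm_of_dot ip)
  (A : H -> set H) (A_maxmon : maximal_monotone ip A)
  (S_nonempty : zeros A !=set0)
  (u : H) (e z y : nat -> H) (c_ lambda gamma delta : nat -> R)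
  (c_gt0 : forall n, 0 < c_ n)
  (lambda_itv : forall n, 0 < lambda n < 1)
  (gamma_itv : forall n, 0 <= gamma n < 1)
  (delta_itv : forall n, 0 < delta n < 1)
  (sum1 : forall n, lambda n + gamma n + delta n = 1)
  (z_rec : forall n, z n.+1 =
    lambda n *: u + gamma n *: z n + delta n *: resolvent A (c_ n) (z n) + e n)
  (y_init : y 0%N = z 0%N)
  (y_rec : forall n, y n.+1 =
    lambda n *: u + gamma n *: y n + delta n *: resolvent A (c_ n) (y n))
  (c : nat) (h l L E : nat -> nat)
  (c_pos : (0 < c)%N) (h_pos : forall n, (0 < h n)%N)
  (h_mon : monotone_fun h) (l_mon : monotone_fun l)
  (L_mon : monotone_fun L) (E_mon : monotone_fun E)
  (cond1 : forall n, 1 / (h n)%:R <= lambda n)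
  (cond2 : forall k n, (l k <= n)%N -> lambda n <= 1 / k.+1%:R)
  (cond3 : forall k, k%:R <= \sum_(1 <= i < (L k).+1) lambda i)
  (cond4 : forall n, 1 / c%:R <= Num.min (c_ n) (delta n ^+ 2))
  (cond5 :
    (forall k n, \sum_((E k).+1 <= i < (E k + n).+1) `|e i| <= 1 / k.+1%:R) \/
    (forall k n, (E k <= n)%N -> `|e n| / lambda n <= 1 / k.+1%:R))
  (D : nat) (D_pos : (0 < D)%N)
  (D_bound : exists2 p, zeros A p & Num.max (2 * `|u - p|) `|z 0%N - p| <= D%:R)
  (C : nat -> nat) (C_mon : monotone_fun C)
  (C_bound : forall n, c_ n <= (C n)%:R)
  (d0 d1 d2 : nat)
  (d0_pos : (0 < d0)%N) (d1_pos : (0 < d1)%N) (d2_pos : (0 < d2)%N)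
  (d0_bound : exists2 q, zeros A q & Num.max `|u - q| `|z 0%N - q| <= d0%:R)
  (d1_bound : \sum_(0 <= i < (E 0%N).+1) `|e i| + 1 <= d1%:R)
  (d2_bound : \big[Num.max/0]_(0 <= i < (E 0%N).+1) `|z i - y i| <= d2%:R)
  (k : nat) (f : nat -> nat) (f_mon : monotone_fun f) :
  (exists2 n, (n <= nu_tilde R c D C h l L E d0 d1 d2 k f)%N &
     forall i, (n <= i <= f n)%N ->
       `|resolvent A (c_ i) (z i) - z i| <= 1 / k.+1%:R) /\
  (exists2 n, (n <= nu_tilde R c D C h l L E d0 d1 d2 (2 * k + 1) f)%N &
     forall i, (n <= i <= f n)%N ->
       `|resolvent A (1 / c%:R) (z i) - z i| <= 1 / k.+1%:R).
Proof.
have [p Ap] := D_bound; rewrite ge_max => /andP[uD z0D].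
have y0D : `|y 0%N - p| <= D%:R by rewrite y_init.
have J_ne n a b : `|resolvent A (c_ n) a - resolvent A (c_ n) b| <= `|a - b|.
  exact: (resolvent_nonexpansive norm_ip A_maxmon S_nonempty _ _ (c_gt0 n)).
have zy_rec n : `|z n.+1 - y n.+1| <= (1 - lambda n) * `|z n - y n| + `|e n|.
  rewrite z_rec y_rec.
  have -> : lambda n *: u + gamma n *: z n + delta n *: resolvent A (c_ n) (z n)
      + e n - (lambda n *: u + gamma n *: y n + delta n *: resolvent A (c_ n) (y n))
    = gamma n *: (z n - y n)
      + delta n *: (resolvent A (c_ n) (z n) - resolvent A (c_ n) (y n)) + e n.
    by vec.
  apply: le_trans (ler_normD _ _) _; rewrite lerD2r.
  apply: le_trans (ler_normD _ _) _.
  have /andP[g0 _] := gamma_itv n; have /andP[/ltW dl0 _] := delta_itv n.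
  rewrite !normrZ !ger0_norm //.
  have -> : 1 - lambda n = gamma n + delta n by rewrite -(sum1 n); ring.
  by rewrite mulrDl lerD2l ler_wpM2l.
have zy_init : `|z 0%N - y 0%N| = 0 by rewrite y_init subrr normr0.
have zy_early n : (n <= E 0%N)%N -> `|z n - y n| <= d2%:R.
  move=> nE; apply: le_trans d2_bound.
  by apply: (@le_bigmax_seq _ _ _ _ 0 n xpredT (fun i => `|z i - y i|));
    rewrite ?mem_index_iota.
have zy_close := error_rate lambda_itv (fun n => normr_ge0 (e n)) zy_rec zy_init
  (fun n => normr_ge0 _) cond3 cond5 d2_pos d1_bound zy_early.
have claim j : exists2 n, (n <= nu_tilde R c D C h l L E d0 d1 d2 j f)%N &
    forall i, (n <= i <= f n)%N ->
      `|resolvent A (c_ i) (z i) - z i| <= 1 / j.+1%:R.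
  have fb_mon : monotone_fun (f_breve R L E d0 d1 d2 j f).
    move=> m; rewrite /f_breve; apply: monotone_leq => //.
    by rewrite geq_max !leq_max leqnSn leqnn orbT.
  have [n nle hn] := mu_tilde_regular norm_ip A_maxmon Ap c_gt0 lambda_itv
    gamma_itv delta_itv sum1 y_rec c_pos cond4 D_pos uD y0D C_mon C_bound h_pos
    h_mon l_mon L_mon cond1 cond2 cond3 (2 * j + 1) fb_mon.
  exists (maxn n (Theta R L E d0 d1 d2 (4 * j + 3))).
    by rewrite /nu_tilde geq_max leq_maxr (leq_trans nle) ?leq_maxl.
  move=> i /andP[]; rewrite geq_max => /andP[ni Ti] ifn.
  have yi := hn i; have zi := zy_close _ _ _ Ti.
  have {}yi : `|resolvent A (c_ i) (y i) - y i| <= (2 * j + 1).+1%:R^-1.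
    by apply: yi; rewrite ni.
  have Jzy := J_ne i (z i) (y i).
  have -> : resolvent A (c_ i) (z i) - z i =
      (resolvent A (c_ i) (z i) - resolvent A (c_ i) (y i))
      + (resolvent A (c_ i) (y i) - y i) - (z i - y i).
    by vec.
  apply: le_trans (ler_normB _ _) _.
  have tri := ler_normD (resolvent A (c_ i) (z i) - resolvent A (c_ i) (y i))
    (resolvent A (c_ i) (y i) - y i).
  move: yi zi; have -> : (2 * j + 1).+1 = (2 * j.+1)%N by lia.
  have -> : (4 * j + 3).+1 = (4 * j.+1)%N by lia.
  rewrite !natrM !invfM => yi zi; rewrite mul1r; move: tri Jzy yi zi.
  move: (j.+1%:R^-1) => v; lra.
split; first exact: claim.
have [n nle hn] := claim (2 * k + 1)%N; exists n => // i /hn hi.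
have T_gt0 : 0 < 1 / c%:R :> R by rewrite divr_gt0 ?ltr0n.
have Tc : 1 / c%:R <= c_ i by apply: le_trans (cond4 i) _; rewrite ge_min lexx.
have [+ _] := resolvent_parameter norm_ip A_maxmon S_nonempty (z i) T_gt0 Tc.
rewrite distrC (distrC (z i)) => /le_trans; apply; apply: (le_trans hi).
by rewrite !mul1r lef_pV2 ?posrE ?ltr0n // ler_nat; lia.
Qed.
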